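(* (Focusing case, spectral instability.) Let $Y=L^2(\mathbb{R},\mathbb{C})$ or $Y=C_b(\mathbb{R},\mathbb{C})$. There exists $\delta>0$ such that for all $(a,b)\in\mathbb{R}^2$ with $ab\neq0$ and $\|(a,b)\|\le\delta$, the small periodic wave $U_{a,b}(x,t)=e^{-it}e^{i\ell_{a,b}x}P_{a,b}(k_{a,b}x)$ of the focusing nonlinear Schrödinger equation $iU_t+U_{xx}+|U|^2U=0$ is spectrally unstable in $Y$: the spectrum in $Y$ of the linearized operator $$\mathcal{A}_{a,b}Q = 4ik_{a,b}^2Q_{zz}-4p_{a,b}k_{a,b}Q_z+i(1-p_{a,b}^2)Q+2i|Q_{a,b}|^2Q+iQ_{a,b}^2\,\overline{Q}$$ contains a point with positive real part.
   Context: Parametrization of the small waves: for $(a,b)\in\mathbb{R}^2$ near $(0,0)$, $\ell_{a,b}\in\mathbb{R}$, $k_{a,b}>0$ and the $2\pi$-periodic function $P_{a,b}:\mathbb{R}\to\mathbb{C}$ with $P_{a,b}(y+\pi)=-P_{a,b}(y)$ depend analytically on $(a,b)$, with $\ell_{0,0}=0$, $k_{0,0}=1$, $P_{0,0}=0$, and are determined by the requirements that $W_{a,b}(x)=e^{i\ell_{a,b}x}P_{a,b}(k_{a,b}x)$ solves $W_{xx}+W+|W|^2W=0$ and that $\frac1{2\pi}\int_0^{2\pi}P_{a,b}(y)e^{iy}dy=a$, $\frac1{2\pi}\int_0^{2\pi}P_{a,b}(y)e^{-iy}dy=b$. As $(a,b)\to(0,0)$: $\ell_{a,b}=\frac14(a^2-b^2)+O(a^4+b^4)$,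 $k_{a,b}=1+\frac34(a^2+b^2)+O(a^4+b^4)$, $P_{a,b}(y)=ae^{-iy}+be^{iy}+O(|ab|(|a|+|b|))$. Set $p_{a,b}=\ell_{a,b}+k_{a,b}$ and $Q_{a,b}(z)=e^{-iz/2}P_{a,b}(z/2)$, so that $W_{a,b}(x)=e^{ip_{a,b}x}Q_{a,b}(2k_{a,b}x)$ with $Q_{a,b}$ $2\pi$-periodic. The wave is a ''periodic wave'' (as opposed to a plane wave) when its modulus is not constant, i.e. $ab\ne0$. $\mathcal{A}_{a,b}$ is the linearization at the equilibrium $Q_{a,b}$ of $iQ_t+4ip_{a,b}k_{a,b}Q_z+4k_{a,b}^2Q_{zz}+(1-p_{a,b}^2)Q+|Q|^2Q=0$, the equation obtained from the Schrödinger equation by $U(x,t)=e^{i(p_{a,b}x-t)}Q(2k_{a,b}x,t)$. It is real-linear on the real space $Y$; its spectrum means the spectrum of its complexification (acting on real and imaginary parts, in $L^2(\mathbb{R},\mathbb{C}^2)$, respectively $C_b(\mathbb{R},\mathbb{C}^2)$, where $C_b$ denotes bounded continuous functions). *)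

(* Defs.v *)
(* The complex numbers over R : realType are R[i], from mathcomp.real_closed.complex. *)
From HB Require Import structures.
From mathcomp Require Import all_boot all_order all_algebra.
From mathcomp Require Import all_classical all_reals all_analysis.
From mathcomp Require Export complex.
Set Implicit Arguments.
Unset Strict Implicit.
Unset Printing Implicit Defensive.
Import Order.TTheory GRing.Theory Num.Theory.
Import numFieldNormedType.Exports.
Local Open Scope classical_set_scope.
Local Open Scope ring_scope.
Local Open Scope complex_scope.

Section Complex.
Context {R : realType}.
Implicit Types (f g W : R -> R[i]).

Definition reC (z : R[i]) : R := complex.Re z.
Definition imC (z : R[i]) : R := complex.Im z.

(* normc is the R-valued modulus; the norm `|z| of R[i] is R[i]-valued. *)
Definition absC (z : R[i]) : R := ComplexField.Normc.normc z.

(* The abstract 'i of numClosedFieldType is only specified up to a choice of root. *)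
Definition iC : R[i] := 0 +i* 1.

Definition expi (t : R) : R[i] := cos t +i* sin t.

Definition is_cderive f g : Prop :=
  forall x : R, is_derive x 1 (reC \o f) (reC (g x)) /\
                is_derive x 1 (imC \o f) (imC (g x)).

(* int_0^(2 pi) f(y) dy *)
Definition cint_period f : R[i] :=
  Rintegral lebesgue_measure `[0, 2 * pi] (reC \o f) +i*
  Rintegral lebesgue_measure `[0, 2 * pi] (imC \o f).

(* W_xx + W + |W|^2 W = 0 *)
Definition solves_profile_eq W : Prop :=
  exists W1 W2 : R -> R[i], [/\ is_cderive W W1, is_cderive W1 W2 &
    forall x, W2 x + W x + ((absC (W x)) ^+ 2)%:C * W x = 0].

End Complex.

Section Parametrization.
Context {R : realType}.

Definition norm2 (a b : R) : R := Num.sqrt (a ^+ 2 + b ^+ 2).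

(* Real analyticity at (a0, b0) of (a, b) |-> F a b as a map into the bounded
   functions T -> R with the sup norm.  The coefficients c m n are bounded
   functions with norm at most M rho^-(m+n), so the double power series converges
   absolutely, in norm, on the open bidisc of radius rho, and summing over
   squares is harmless.  T = unit gives real-valued analytic functions. *)
Definition analytic_at (T : Type) (F : R -> R -> T -> R) (a0 b0 : R) : Prop :=
  exists (rho M : R) (c : nat -> nat -> T -> R),
    [/\ 0 < rho,
        forall m n t, `|c m n t| <= M / rho ^+ (m + n) &
        forall a b t, `|a - a0| < rho -> `|b - b0| < rho ->
          (\sum_(m < N) \sum_(n < N)
             c m n t * (a - a0) ^+ m * (b - b0) ^+ n) @[N --> \oo]
          --> F a b t].

Definition wave_W (ell k : R) (P : R -> R[i]) : R -> R[i] :=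
  fun x => expi (ell * x) * P (k * x).

(* ell, k and P are total, but constrained only on some ball around (0, 0). *)
Definition small_wave_family (ell k : R -> R -> R) (P : R -> R -> R -> R[i])
    : Prop :=
  exists r : R, [/\ 0 < r,
    [/\ ell 0 0 = 0, k 0 0 = 1 & forall y, P 0 0 y = 0],
    forall a b, norm2 a b < r ->
      [/\ 0 < k a b,
          forall y, P a b (y + 2 * pi) = P a b y &
          forall y, P a b (y + pi) = - P a b y] /\
      [/\ solves_profile_eq (wave_W (ell a b) (k a b) (P a b)),
          ((2 * pi)^-1)%:C * cint_period (fun y => P a b y * expi y) = a%:C &
          ((2 * pi)^-1)%:C * cint_period (fun y => P a b y * expi (- y)) = b%:C],
    forall a b, norm2 a b < r ->
      [/\ analytic_at (fun a b (_ : unit) => ell a b) a b,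
          analytic_at (fun a b (_ : unit) => k a b) a b,
          analytic_at (fun a b y => reC (P a b y)) a b &
          analytic_at (fun a b y => imC (P a b y)) a b] &
    exists C : R, forall a b, norm2 a b < r ->
      [/\ `|ell a b - (a ^+ 2 - b ^+ 2) / 4| <= C * (a ^+ 4 + b ^+ 4),
          `|k a b - (1 + 3 / 4 * (a ^+ 2 + b ^+ 2))| <= C * (a ^+ 4 + b ^+ 4) &
          forall y, absC (P a b y - (a%:C * expi (- y) + b%:C * expi y))
                    <= C * (`|a * b| * (`|a| + `|b|))]].

Definition wave_p (ell k : R) : R := ell + k.

Definition wave_Q (P : R -> R[i]) : R -> R[i] :=
  fun z => expi (- (z / 2)) * P (z / 2).

End Parametrization.

(* A space of functions on the line, described by its real-valued elements:
   the complex space Y = L^2(R, C) or C_b(R, C) consists of the functions whose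
   real and imaginary parts satisfy [fmem], and likewise for values in C^2.
   [fderiv f g] reads f' = g, and [fnorm] is the norm of a function that is
   meant to be applied to the pointwise modulus of vector-valued functions. *)
Record funspace (R : realType) := FunSpace {
  fmem : (R -> R) -> Prop;
  feq : (R -> R) -> (R -> R) -> Prop;
  fderiv : (R -> R) -> (R -> R) -> Prop;
  fnorm : (R -> R) -> \bar R
}.

Section Spaces.
Variable R : realType.

Definition test_function (phi : R -> R) : Prop :=
  (forall n x, derivable (derive1n n phi) x 1) /\
  (exists M : R, forall x, M < `|x| -> phi x = 0).

Definition weak_deriv (f g : R -> R) : Prop :=
  forall phi, test_function phi ->
    Rintegral lebesgue_measure setT (fun x : R => f x * derive1 phi x) =
    - Rintegral lebesgue_measure setT (fun x : R => g x * phi x).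

(* Elements are functions, identified by [feq] when equal almost everywhere. *)
Definition L2_space : funspace R := {|
  fmem := fun f => f \in Lfun (@lebesgue_measure R) 2%:E;
  feq := fun f g => {ae @lebesgue_measure R, forall x, f x = g x};
  fderiv := weak_deriv;
  fnorm := fun f => Lnorm (@lebesgue_measure R) 2%:E (EFin \o f) |}.

Definition Cb_space : funspace R := {|
  fmem := fun f => continuous f /\ exists M : R, forall x, `|f x| <= M;
  feq := fun f g => forall x, f x = g x;
  fderiv := fun f g => forall x : R, is_derive x 1 f (g x);
  fnorm := fun f => ereal_sup (range (fun x : R => `|f x|%:E)) |}.

End Spaces.

Section Spectrum.
Context {R : realType}.
Variable Y : funspace R.
Implicit Types (q : R -> R[i]) (w f : R -> R[i] * R[i]).

Definition memY q : Prop := fmem Y (reC \o q) /\ fmem Y (imC \o q).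
Definition eqY (q1 q2 : R -> R[i]) : Prop :=
  feq Y (reC \o q1) (reC \o q2) /\ feq Y (imC \o q1) (imC \o q2).
Definition derivY (q1 q2 : R -> R[i]) : Prop :=
  fderiv Y (reC \o q1) (reC \o q2) /\ fderiv Y (imC \o q1) (imC \o q2).

(* An unbounded real-linear operator in Y is given by its graph. *)
Definition operator := (R -> R[i]) -> (R -> R[i]) -> Prop.

(* Graph of 4 i k^2 d_zz - 4 p k d_z + i (1 - p^2) + 2 i |Q|^2 + i Q^2 conj,
   with domain the elements of Y whose first two derivatives are in Y, that is
   H^2(R, C) in L^2 and C_b^2(R, C) in C_b. *)
Definition linearized_op (p k : R) (Q : R -> R[i]) : operator :=
  fun q g => exists q1 q2 : R -> R[i],
    [/\ [/\ memY q, memY q1 & memY q2], derivY q q1, derivY q1 q2 &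
      eqY g (fun z =>
          (4 * k ^+ 2)%:C * iC * q2 z - (4 * p * k)%:C * q1 z
        + (1 - p ^+ 2)%:C * iC * q z
        + (2 * absC (Q z) ^+ 2)%:C * iC * q z
        + iC * Q z ^+ 2 * conjc (q z))].

(* The complexification of Y = {(u, v) real} is the space of complex-valued
   (u, v) : R -> C^2.  Its element w = (u, v) is w_re + i w_im, where
   w_re = (Re u, Re v) and w_im = (Im u, Im v) are in Y, that is, are identified
   with Re u + i Re v and Im u + i Im v. *)
Definition w_re w : R -> R[i] := fun x => reC (w x).1 +i* reC (w x).2.
Definition w_im w : R -> R[i] := fun x => imC (w x).1 +i* imC (w x).2.

Definition mem_complexified w : Prop := memY (w_re w) /\ memY (w_im w).
Definition eq_complexified (w f : R -> R[i] * R[i]) : Prop :=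
  eqY (w_re w) (w_re f) /\ eqY (w_im w) (w_im f).
Definition complexified (A : operator) (w f : R -> R[i] * R[i]) : Prop :=
  A (w_re w) (w_re f) /\ A (w_im w) (w_im f).
Definition norm_complexified w : \bar R :=
  fnorm Y (fun x => Num.sqrt (absC (w x).1 ^+ 2 + absC (w x).2 ^+ 2)).

(* (A - lambda) w = f for the complexification of A *)
Definition resolvent_eq (A : operator) (lambda : R[i]) w f : Prop :=
  complexified A w (fun x => (lambda * (w x).1 + (f x).1,
                              lambda * (w x).2 + (f x).2)).

(* A - lambda is a bijection from the domain onto the complexified space, with
   bounded inverse. *)
Definition resolvent_set (A : operator) (lambda : R[i]) : Prop :=
  [/\ forall f, mem_complexified f -> exists w, resolvent_eq A lambda w f,
      forall w w' f, mem_complexified f ->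
        resolvent_eq A lambda w f -> resolvent_eq A lambda w' f ->
        eq_complexified w w' &
      exists C : R, forall w f, mem_complexified f ->
        resolvent_eq A lambda w f ->
        (norm_complexified w <= C%:E * norm_complexified f)%E].

Definition spectrum (A : operator) (lambda : R[i]) : Prop :=
  ~ resolvent_set A lambda.

(* Spectral instability of U(x, t) = e^(-it) e^(i ell x) P(k x). *)
Definition spectrally_unstable (ell k : R) (P : R -> R[i]) : Prop :=
  exists lambda : R[i],
    spectrum (linearized_op (wave_p ell k) k (wave_Q P)) lambda /\
    0 < reC lambda.

End Spectrum.

(* Main.v *)
Require Import Defs.
From HB Require Import structures.
From mathcomp Require Import all_boot all_order all_algebra.
From mathcomp Require Import all_classical all_reals all_analysis.
From mathcomp Require Import measurable_realfun.
From mathcomp Require Import ring lra.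
Set Implicit Arguments.
Unset Strict Implicit.
Unset Printing Implicit Defensive.
Import Order.TTheory GRing.Theory Num.Theory.
Import numFieldNormedType.Exports.
Local Open Scope ring_scope.
Local Open Scope complex_scope.
Local Notation cj := conjc.

(** The cubic equation is integrable, and this makes the unstable modes of its
    waves explicit.  Let W solve W'' + W + |W|^2 W = 0, and for a complex zeta
    let A, B, C be the entries of the second matrix of its Lax pair [laxA, laxB,
    laxC].  Then Omega^2 = A^2 + B C / 2 does not depend on x [laxdet_cst], and

      v = B exp(theta),  w = - 2 (Omega - A)^2 exp(theta) / B,
      theta' = 2 Omega W / B,

    solve the linearized equation with eigenvalue lambda = 2 Omega
    [bloch_mode_of_lax].  For a quasi-periodic W the quotient W / B is periodic;
    if m is its mean value, (v, w) is bounded exactly when Re(Omega m) = 0.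
    So an unstable bounded mode exists as soon as, for some zeta, the number
    Omega^2 m^2 is real and negative and m is not real: then
    Omega = i tau / m with tau real, and Re(Omega) is a nonzero multiple of
    tau Im(m), positive for one of the two signs of Omega
    [unstable_mode_of_lax].

    Such a zeta is found next to 1/2 when |b| <= |a|; the reflection x -> - x
    covers the other case.  Put zeta = 1/2 + s with s = |a| (t + i/2) and t
    in [-1, 1].  Up to the phase exp(i ell x) and terms of higher order, W is
    a exp(-ikx) u with u = 1 + (b/a) exp(2ikx), and W + i W' is 2 a exp(-ikx), so
    that W / B is close to u (1 - s u) / 2.  Hence m = (1 - s) / 2 + O(a^2) is not real
    [mean_approx], whereas Omega^2 = - 4 s^2 - 2 a^2 + O(a^3)
    [laxdet_approx], so that 4 Omega^2 m^2 / a^2 = - (1 + 4 t^2) - 4 i t + O(a).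
    Its real part is negative and its imaginary part changes sign, so it is real
    for some t [unstable_mode_of_estimates].

    Finally, a bounded mode that is bounded away from zero puts lambda in the
    spectrum in both spaces at once [spectrum_of_bounded_mode].  Multiplied by a
    cutoff whose first two derivatives are pointwise O(e) times the cutoff itself,
    the mode becomes an element w of the domain with
    |(A - lambda) w| <= K e |w| at every point, hence also in norm, which
    excludes a bounded inverse as e tends to 0. *)

(** * Calculus of complex-valued functions of a real variable *)

Section RealDerivatives.
Context {R : realType}.
Implicit Types (f g : R -> R) (x a b : R).

Lemma rder_eq f x a b : is_derive x 1 f a -> a = b -> is_derive x 1 f b.
Proof. by move=> h <-. Qed.

Lemma rderD f g x a b : is_derive x 1 f a -> is_derive x 1 g b ->
  is_derive x 1 (fun y => f y + g y) (a + b).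
Proof. exact: is_deriveD. Qed.

Lemma rderN f x a : is_derive x 1 f a -> is_derive x 1 (fun y => - f y) (- a).
Proof. exact: is_deriveN. Qed.

Lemma rderB f g x a b : is_derive x 1 f a -> is_derive x 1 g b ->
  is_derive x 1 (fun y => f y - g y) (a - b).
Proof. exact: is_deriveB. Qed.

Lemma rderM f g x a b : is_derive x 1 f a -> is_derive x 1 g b ->
  is_derive x 1 (fun y => f y * g y) (a * g x + f x * b).
Proof.
move=> ha hb; apply: (rder_eq (is_deriveM ha hb)).
by rewrite /GRing.scale /= addrC [g x * a]mulrC.
Qed.

Lemma rderV f x a : f x != 0 -> is_derive x 1 f a ->
  is_derive x 1 (fun y => (f y)^-1) (- a / f x ^+ 2).
Proof.
move=> h0 h; apply: (rder_eq (is_deriveV h0 h)).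
by rewrite /GRing.scale /= mulrC mulrN mulNr.
Qed.

Lemma rder_lin (c d x : R) : is_derive x 1 (fun y => c * y + d) c.
Proof.
apply: (rder_eq (rderD (rderM (is_derive_cst c x 1) (is_derive_id x 1))
  (is_derive_cst d x 1))).
by rewrite mul0r add0r mulr1 addr0.
Qed.

Lemma rder_comp_lin f (c d x a : R) : is_derive (c * x + d) 1 f a ->
  is_derive x 1 (fun y => f (c * y + d)) (c * a).
Proof.
move=> h; have := @is_derive1_comp R f (fun y => c * y + d) x a c h (rder_lin c d x).
by move=> h'; apply: (rder_eq h'); rewrite mulrC.
Qed.

Lemma rder_continuous f x a : is_derive x 1 f a -> {for x, continuous f}.
Proof. by move=> h; apply: differentiable_continuous; apply/derivable1_diffP. Qed.

End RealDerivatives.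

Section ComplexDerivatives.
Context {R : realType}.
Implicit Types (f g : R -> R[i]) (x : R) (a b : R[i]).

Definition cder f x a :=
  is_derive x 1 (reC \o f) (reC a) /\ is_derive x 1 (imC \o f) (imC a).

Lemma reCD a b : reC (a + b) = reC a + reC b. Proof. by case: a; case: b. Qed.
Lemma imCD a b : imC (a + b) = imC a + imC b. Proof. by case: a; case: b. Qed.
Lemma reCN a : reC (- a) = - reC a. Proof. by case: a. Qed.
Lemma imCN a : imC (- a) = - imC a. Proof. by case: a. Qed.
Lemma reCM a b : reC (a * b) = reC a * reC b - imC a * imC b.
Proof. by case: a; case: b. Qed.
Lemma imCM a b : imC (a * b) = reC a * imC b + imC a * reC b.
Proof. by case: a; case: b. Qed.
Lemma eq_reim a b : reC a = reC b -> imC a = imC b -> a = b.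
Proof. by case: a; case: b => ? ? ? ? /= -> ->. Qed.

Lemma cder_eq f x a b : cder f x a -> a = b -> cder f x b.
Proof. by move=> h <-. Qed.

Lemma cder_ext f g x a : f =1 g -> cder f x a -> cder g x a.
Proof. by move=> /funext ->. Qed.

Lemma cder_cst a x : cder (fun=> a) x 0.
Proof. by split; exact: is_derive_cst. Qed.

Lemma cderD f g x a b : cder f x a -> cder g x b ->
  cder (fun y => f y + g y) x (a + b).
Proof.
move=> [fr fi] [gr gi]; split.
- have -> : reC \o (fun y => f y + g y) = fun y => (reC \o f) y + (reC \o g) y.
    by apply/funext => y /=; rewrite reCD.
  by rewrite reCD; exact: rderD.
- have -> : imC \o (fun y => f y + g y) = fun y => (imC \o f) y + (imC \o g) y.
    by apply/funext => y /=; rewrite imCD.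
  by rewrite imCD; exact: rderD.
Qed.

Lemma cderN f x a : cder f x a -> cder (fun y => - f y) x (- a).
Proof.
move=> [fr fi]; split.
- have -> : reC \o (fun y => - f y) = fun y => - (reC \o f) y.
    by apply/funext => y /=; rewrite reCN.
  by rewrite reCN; exact: rderN.
- have -> : imC \o (fun y => - f y) = fun y => - (imC \o f) y.
    by apply/funext => y /=; rewrite imCN.
  by rewrite imCN; exact: rderN.
Qed.

Lemma cderB f g x a b : cder f x a -> cder g x b ->
  cder (fun y => f y - g y) x (a - b).
Proof. by move=> hf hg; exact: cderD hf (cderN hg). Qed.

Lemma cderM f g x a b : cder f x a -> cder g x b ->
  cder (fun y => f y * g y) x (a * g x + f x * b).
Proof.
move=> [fr fi] [gr gi]; split.
- have -> : reC \o (fun y => f y * g y) =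
      fun y => (reC \o f) y * (reC \o g) y - (imC \o f) y * (imC \o g) y.
    by apply/funext => y /=; rewrite reCM.
  apply: (rder_eq (rderB (rderM fr gr) (rderM fi gi))).
  by rewrite reCD !reCM /=; ring.
- have -> : imC \o (fun y => f y * g y) =
      fun y => (reC \o f) y * (imC \o g) y + (imC \o f) y * (reC \o g) y.
    by apply/funext => y /=; rewrite imCM.
  apply: (rder_eq (rderD (rderM fr gi) (rderM fi gr))).
  by rewrite imCD !imCM /=; ring.
Qed.

Lemma cderZ f x a b : cder f x a -> cder (fun y => b * f y) x (b * a).
Proof.
by move=> h; apply: (cder_eq (cderM (cder_cst b x) h)); rewrite mul0r add0r.
Qed.

Lemma cder_conj f x a : cder f x a -> cder (fun y => cj (f y)) x (cj a).
Proof.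
move=> [fr fi]; split.
- have -> : reC \o (fun y => cj (f y)) = reC \o f.
    by apply/funext => y /=; case: (f y).
  by case: a fr fi => ? ?.
- have -> : imC \o (fun y => cj (f y)) = fun y => - (imC \o f) y.
    by apply/funext => y /=; case: (f y).
  by case: a fr fi => ? ? fr fi; exact: rderN.
Qed.

Lemma cder_real (h : R -> R) x (d : R) : is_derive x 1 h d ->
  cder (fun y => (h y)%:C) x d%:C.
Proof. by move=> hd; split => //; exact: is_derive_cst. Qed.

Lemma cder_comp_lin f (c d x : R) a : cder f (c * x + d) a ->
  cder (fun y => f (c * y + d)) x (c%:C * a).
Proof.
move=> [fr fi]; split.
- apply: (rder_eq (rder_comp_lin fr)).
  by rewrite reCM /= mul0r subr0.
- apply: (rder_eq (rder_comp_lin fi)).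
  by rewrite imCM /= mul0r addr0.
Qed.

Lemma cder_continuous f x a : cder f x a ->
  {for x, continuous (reC \o f)} /\ {for x, continuous (imC \o f)}.
Proof. by move=> [/rder_continuous ? /rder_continuous ?]. Qed.

(** ** Modulus *)

Lemma absCE a : absC a = Num.sqrt (reC a ^+ 2 + imC a ^+ 2).
Proof. by case: a. Qed.

Lemma absC_sqr a : absC a ^+ 2 = reC a ^+ 2 + imC a ^+ 2.
Proof. by rewrite absCE sqr_sqrtr // addr_ge0 // sqr_ge0. Qed.

Lemma absC_ge0 a : 0 <= absC a. Proof. by rewrite absCE sqrtr_ge0. Qed.

Lemma absCM a b : absC (a * b) = absC a * absC b.
Proof. exact: ComplexField.Normc.normcM. Qed.

Lemma absCV a : absC a^-1 = (absC a)^-1.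
Proof. exact: ComplexField.Normc.normcV. Qed.

Lemma absCN a : absC (- a) = absC a.
Proof. by rewrite !absCE reCN imCN !sqrrN. Qed.

Lemma absCJ a : absC (cj a) = absC a.
Proof. by case: a => u v; rewrite !absCE /= sqrrN. Qed.

Lemma absC0 : absC (0 : R[i]) = 0.
Proof. by rewrite absCE /= expr0n /= addr0 sqrtr0. Qed.

Lemma absCD a b : absC (a + b) <= absC a + absC b.
Proof. exact: le_normcD. Qed.

Lemma absCB a b : absC (a - b) <= absC a + absC b.
Proof. by rewrite -(absCN b) absCD. Qed.

Lemma absC_real (r : R) : absC r%:C = `|r|.
Proof. by rewrite absCE /= expr0n /= addr0 sqrtr_sqr. Qed.

Lemma absC_nat (n : nat) : absC (n%:R : R[i]) = n%:R.
Proof.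
have -> : (n%:R : R[i]) = (n%:R)%:C by rewrite rmorph_nat.
by rewrite absC_real normr_nat.
Qed.

Lemma absCX a n : absC (a ^+ n) = absC a ^+ n.
Proof.
elim: n => [|n IH]; first by rewrite !expr0 (absC_real 1) normr1.
by rewrite !exprS absCM IH.
Qed.

Lemma absC_iC : absC (iC : R[i]) = 1.
Proof. by rewrite absCE /= expr0n expr1n add0r sqrtr1. Qed.

Lemma absC_eq0 a : (absC a == 0) = (a == 0).
Proof.
apply/eqP/eqP => [|->]; last exact: absC0.
exact: ComplexField.Normc.eq0_normc.
Qed.

Lemma absC_neq0 a : 0 < absC a -> a != 0.
Proof. by rewrite -absC_eq0 => /lt0r_neq0. Qed.

Lemma ler_reC a : `|reC a| <= absC a.
Proof. by rewrite absCE -sqrtr_sqr ler_wsqrtr // lerDl sqr_ge0. Qed.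

Lemma ler_imC a : `|imC a| <= absC a.
Proof. by rewrite absCE -sqrtr_sqr ler_wsqrtr // lerDr sqr_ge0. Qed.

Lemma absC_le_reim a : absC a <= `|reC a| + `|imC a|.
Proof.
rewrite {1}(_ : a = (reC a)%:C + iC * (imC a)%:C); last first.
  by case: a => u v; apply: eq_reim; rewrite ?reCD ?imCD ?reCM ?imCM /=; ring.
by apply: (le_trans (absCD _ _)); rewrite absCM absC_iC mul1r !absC_real.
Qed.

Lemma mulCJ a : a * cj a = (absC a ^+ 2)%:C.
Proof. by rewrite absC_sqr; case: a => u v; apply: eq_reim; rewrite ?reCM ?imCM /=; ring. Qed.

Lemma iC2 : (iC : R[i]) ^+ 2 = -1.
Proof. by apply: eq_reim; rewrite expr2 ?reCM ?imCM ?reCN ?imCN /=; ring. Qed.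

Lemma iC_neq0 : (iC : R[i]) != 0.
Proof. by apply: absC_neq0; rewrite absC_iC. Qed.

Lemma conj_iC : cj (iC : R[i]) = - iC.
Proof. by apply: eq_reim => /=; rewrite ?oppr0. Qed.

Lemma conjCD a b : cj (a + b) = cj a + cj b. Proof. exact: rmorphD. Qed.
Lemma conjCM a b : cj (a * b) = cj a * cj b. Proof. exact: rmorphM. Qed.
Lemma conjCX a n : cj (a ^+ n) = cj a ^+ n. Proof. exact: rmorphXn. Qed.
Lemma conjCN a : cj (- a) = - cj a. Proof. exact: rmorphN. Qed.

(** ** Inverse, exponentials *)

Lemma cderV f x a : f x != 0 -> cder f x a ->
  cder (fun y => (f y)^-1) x (- a / f x ^+ 2).
Proof.
move=> f0 hf.
pose n y := reC (f y) ^+ 2 + imC (f y) ^+ 2.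
have n0 : n x != 0 by rewrite /n -absC_sqr expf_neq0 // absC_eq0.
have hn : is_derive x 1 n (2 * (reC (f x) * reC a + imC (f x) * imC a)).
  have -> : n = fun y => (reC \o f) y * (reC \o f) y + (imC \o f) y * (imC \o f) y.
    by apply/funext => y; rewrite /n !expr2.
  case: hf => fr fi; apply: (rder_eq (rderD (rderM fr fr) (rderM fi fi))).
  by rewrite /=; ring.
have E y : (f y)^-1 = cj (f y) * ((n y)^-1)%:C.
  rewrite /n; case: (f y) => u v; apply: eq_reim; rewrite /= ?mulr0 ?subr0 ?add0r //.
  by rewrite mulNr.
apply: (cder_ext (fun y => esym (E y))).
apply: (cder_eq (cderM (cder_conj hf) (cder_real (rderV n0 hn)))).
have nE : (n x)%:C = f x * cj (f x) by rewrite mulCJ absC_sqr.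
have fb0 : cj (f x) != 0 by rewrite conjc_eq0.
have -> : (- (2 * (reC (f x) * reC a + imC (f x) * imC a)) / n x ^+ 2)%:C
   = - (f x * cj a + cj (f x) * a) / (n x)%:C ^+ 2.
  rewrite rmorphM rmorphN fmorphV rmorphXn /=; congr (- _ * _).
  by case: (f x) => u v; case: (a) => c d; apply: eq_reim; rewrite ?reCD ?imCD ?reCM ?imCM /=; ring.
by rewrite fmorphV /= nE; field; rewrite f0 fb0.
Qed.

Lemma expiD (s t : R) : expi (s + t) = expi s * expi t.
Proof. by apply: eq_reim; rewrite ?reCM ?imCM /= ?cosD ?sinD; ring. Qed.

Lemma expi0 : expi (0 : R) = 1.
Proof. by apply: eq_reim; rewrite /= ?cos0 ?sin0. Qed.

Lemma expiNV (t : R) : expi (- t) * expi t = 1.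
Proof. by rewrite -expiD addNr expi0. Qed.

Lemma expiJ (t : R) : cj (expi t) = expi (- t).
Proof. by apply: eq_reim; rewrite /= ?cosN ?sinN. Qed.

Lemma absC_expi (t : R) : absC (expi t) = 1.
Proof. by rewrite absCE /= cos2Dsin2 sqrtr1. Qed.

Lemma cder_expi (c d x : R) :
  cder (fun y => expi (c * y + d)) x (c%:C * (iC * expi (c * x + d))).
Proof.
apply: cder_comp_lin; split.
- by apply: (rder_eq (is_derive_cos _)); rewrite reCM /=; ring.
- by apply: (rder_eq (is_derive_sin _)); rewrite imCM /=; ring.
Qed.

Definition cexp a : R[i] := (expR (reC a))%:C * expi (imC a).

Lemma absC_cexp a : absC (cexp a) = expR (reC a).
Proof. by rewrite absCM absC_real absC_expi mulr1 ger0_norm ?expR_ge0. Qed.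

Lemma cder_cexp f x a : cder f x a -> cder (fun y => cexp (f y)) x (a * cexp (f x)).
Proof.
move=> [fr fi].
have he : is_derive x 1 (fun y => expR (reC (f y))) (expR (reC (f x)) * reC a).
  exact: (@is_derive1_comp R expR (reC \o f)).
have hx : cder (fun y => expi (imC (f y))) x ((imC a)%:C * (iC * expi (imC (f x)))).
  split.
  - apply: (rder_eq (@is_derive1_comp R cos (imC \o f) x _ _ (is_derive_cos _) fi)).
    by rewrite !reCM /=; ring.
  - apply: (rder_eq (@is_derive1_comp R sin (imC \o f) x _ _ (is_derive_sin _) fi)).
    by rewrite !imCM /=; ring.
apply: (cder_eq (cderM (cder_real he) hx)).
rewrite /cexp rmorphM /= [in RHS](_ : a = (reC a)%:C + iC * (imC a)%:C); first by ring.
by case: (a) => u v; apply: eq_reim; rewrite ?reCD ?imCD ?reCM ?imCM /=; ring.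
Qed.

(** ** Continuity *)

Definition ccont f := continuous (@reC R \o f) /\ continuous (@imC R \o f).

Lemma ccont_cst a : ccont (fun=> a).
Proof. by split => x; exact: cvg_cst. Qed.

Lemma ccontD f g : ccont f -> ccont g -> ccont (fun x => f x + g x).
Proof.
move=> [fr fi] [gr gi]; split.
- have -> : reC \o (fun x => f x + g x) = (reC \o f) \+ (reC \o g).
    by apply/funext => x /=; rewrite reCD.
  by move=> x; exact: continuousD (fr x) (gr x).
- have -> : imC \o (fun x => f x + g x) = (imC \o f) \+ (imC \o g).
    by apply/funext => x /=; rewrite imCD.
  by move=> x; exact: continuousD (fi x) (gi x).
Qed.

Lemma ccontM f g : ccont f -> ccont g -> ccont (fun x => f x * g x).
Proof.
move=> [fr fi] [gr gi]; split.
- have -> : reC \o (fun x => f x * g x) =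
      (fun x => (reC \o f) x * (reC \o g) x) \- (fun x => (imC \o f) x * (imC \o g) x).
    by apply/funext => x /=; rewrite reCM.
  by move=> x; exact: continuousB (continuousM (fr x) (gr x)) (continuousM (fi x) (gi x)).
- have -> : imC \o (fun x => f x * g x) =
      (fun x => (reC \o f) x * (imC \o g) x) \+ (fun x => (imC \o f) x * (reC \o g) x).
    by apply/funext => x /=; rewrite imCM.
  by move=> x; exact: continuousD (continuousM (fr x) (gi x)) (continuousM (fi x) (gr x)).
Qed.

Lemma ccontN f : ccont f -> ccont (fun x => - f x).
Proof.
move=> hf; rewrite (_ : (fun _ => _) = fun x => -1 * f x).
  exact: ccontM (ccont_cst _) hf.
by apply/funext => x; rewrite mulN1r.
Qed.

Lemma ccontJ f : ccont f -> ccont (fun x => cj (f x)).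
Proof.
move=> [fr fi]; split.
- by rewrite (_ : _ \o _ = reC \o f) //; apply/funext => x /=; case: (f x).
- rewrite (_ : _ \o _ = fun x => - (imC \o f) x); last first.
    by apply/funext => x /=; case: (f x).
  by move=> x; exact: continuousN (fi x).
Qed.

Lemma ccont_real (h : R -> R) : continuous h -> ccont (fun x => (h x)%:C).
Proof. by move=> ch; split => // x; exact: cvg_cst. Qed.

Lemma ccont_cder f g : (forall x, cder f x (g x)) -> ccont f.
Proof. by move=> h; split=> x; have [] := cder_continuous (h x). Qed.

Lemma lipschitz_continuous (h : R -> R) (M : R) :
  (forall x y, `|h x - h y| <= M * `|x - y|) -> continuous h.
Proof.
move=> hM x; apply/cvgrPdist_le => e e0.
have M1 : 0 < `|M| + 1 by rewrite ltr_wpDl.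
near=> y; apply: (le_trans (hM x y)).
have xy : `|x - y| < e / (`|M| + 1).
  by near: y; apply: (@cvgr_dist_lt _ _ _ (nbhs x) _ id) => //; rewrite divr_gt0.
apply: le_trans (_ : (`|M| + 1) * `|x - y| <= e).
  by apply: ler_wpM2r => //; rewrite (le_trans (ler_norm _)) // lerDl.
by rewrite mulrC -ler_pdivlMr // ltW.
Unshelve. all: by end_near. Qed.

Lemma ccont_lip f (M : R) :
  (forall x y, absC (f x - f y) <= M * `|x - y|) -> ccont f.
Proof.
move=> h; split; apply: (@lipschitz_continuous _ M) => x y; apply: le_trans (h x y).
- by rewrite /= -reCN -reCD ler_reC.
- by rewrite /= -imCN -imCD ler_imC.
Qed.

(** ** Mean value inequality *)

Lemma rder_lip (f df : R -> R) (M x y : R) : (forall t : R, is_derive t 1 f (df t)) ->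
  (forall t, `|df t| <= M) -> `|f y - f x| <= M * `|y - x|.
Proof.
move=> hf hM.
wlog xy : x y / x < y.
  move=> H; have [|yx|->] := ltgtP x y; first exact: H.
  - by rewrite distrC (distrC y); exact: H.
  - by rewrite !subrr normr0 mulr0.
have [|c _ ->] := @MVT R f df x y xy (fun t _ => hf t).
  by apply: continuous_subspaceT => t; exact: rder_continuous (hf t).
by rewrite normrM ler_wpM2r.
Qed.

Lemma cder_lip f g (M x y : R) : (forall t, cder f t (g t)) ->
  (forall t, absC (g t) <= M) -> absC (f y - f x) <= 2 * M * `|y - x|.
Proof.
move=> hf hM; apply: (le_trans (absC_le_reim _)).
rewrite reCD imCD reCN imCN -mulrA mulr_natl mulr2n; apply: lerD.
- apply: (@rder_lip (reC \o f) (reC \o g)) => t; first by have [] := hf t.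
  exact: le_trans (ler_reC _) (hM t).
- apply: (@rder_lip (imC \o f) (imC \o g)) => t; first by have [] := hf t.
  exact: le_trans (ler_imC _) (hM t).
Qed.

Lemma cder_unique f x a b : cder f x a -> cder f x b -> a = b.
Proof.
move=> [ar ai] [br bi]; apply: eq_reim.
- by rewrite -(@derive_val _ _ _ _ _ _ _ ar) (@derive_val _ _ _ _ _ _ _ br).
- by rewrite -(@derive_val _ _ _ _ _ _ _ ai) (@derive_val _ _ _ _ _ _ _ bi).
Qed.

Lemma cder0_cst f : (forall x, cder f x 0) -> forall x y, f x = f y.
Proof.
move=> h x y; apply/eqP; rewrite -subr_eq0 -absC_eq0 -normr_le0.
rewrite ger0_norm ?absC_ge0 //.
apply: (le_trans (@cder_lip f (fun=> 0) 0 y x h _)) => [t|].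
  by rewrite absC0.
by rewrite mulr0 mul0r.
Qed.

End ComplexDerivatives.

Section Antiderivatives.
Context {R : realType}.
Implicit Types (f : R -> R).

Lemma antiderivative_from f (a : R) : continuous f ->
  exists G : R -> R, forall x : R, a < x -> is_derive x 1 G (f x).
Proof.
move=> cf.
pose G x := Rintegral (@lebesgue_measure R) `[a, x]%classic f.
exists G => x ax.
have [] := @continuous_FTC1 R f (BLeft a) x (x + 1) _ _ _ (cf x).
- by rewrite ltrDl.
- apply: continuous_compact_integrable; first exact: segment_compact.
  exact: continuous_subspaceT.
- by rewrite lte_fin.
- by move=> dG eG; split; [exact: dG|rewrite -derive1E; exact: eG].
Qed.

(** The primitives based at different points on the left of 0 agree once they
    are normalized to vanish at 0; they are glued by letting the base point
    depend on x. *)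
Lemma antiderivative f : continuous f ->
  exists F : R -> R, forall x : R, is_derive x 1 F (f x).
Proof.
move=> cf.
have [G hG] := choice (fun a => antiderivative_from a cf).
pose H a x := G a x - G a 0.
have dH (a x : R) : a < x -> is_derive x 1 (H a) (f x).
  move=> ax; apply: (rder_eq (rderB (hG a x ax) (is_derive_cst (G a 0) x 1))).
  by rewrite subr0.
have HE (a b x : R) : a < 0 -> b < 0 -> a < x -> b < x -> H a x = H b x.
  move=> a0 b0 ax bx.
  pose D y := H a y - H b y.
  have D0 (y : R) : a < y -> b < y -> is_derive y 1 D 0.
    by move=> ay by_; apply: (rder_eq (rderB (dH a y ay) (dH b y by_))); rewrite subrr.
  suff : D x = D 0 by rewrite /D /H; lra.
  have cst (u v : R) : u < v -> a < u -> b < u -> D v = D u.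
    move=> uv au bu.
    have [t||c _] := @MVT R D (fun=> 0) u v uv.
    - by rewrite in_itv /= => /andP[ut _]; apply: D0; apply: lt_trans ut.
    - apply: derivable_within_continuous => t.
      rewrite in_itv /= => /andP[ut _].
      by have := D0 t (lt_le_trans au ut) (lt_le_trans bu ut).
    - by rewrite mul0r => /eqP; rewrite subr_eq0 => /eqP.
  have [x0|x0|->//] := ltgtP x 0; last exact: cst.
  by apply/esym; exact: cst.
exists (fun x => H (- (`|x| + 1)) x) => x.
apply: (@near_eq_is_derive _ _ _ (H (- (`|x| + 3)))); last first.
  by apply: dH; have := ler_norm (- x); rewrite normrN; lra.
near=> y.
have xy : `|x - y| < 1 by near: y; exact: (@cvgr_dist_lt _ _ _ (nbhs x) _ id).
have := ler_norm (- y); have := ler_norm (- x); have := ler_norm y.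
have := ler_norm x; have := ler_norm (x - y); have := ler_norm (- (x - y)).
by move: xy (normr_ge0 x) (normr_ge0 y); rewrite !normrN => *; apply: HE; lra.
Unshelve. all: by end_near. Qed.

Lemma cantiderivative (f : R -> R[i]) :
  continuous (@reC R \o f) -> continuous (@imC R \o f) ->
  exists F : R -> R[i], F 0 = 0 /\ forall x, cder F x (f x).
Proof.
move=> /antiderivative[F hF] /antiderivative[G hG].
exists (fun x => (F x +i* G x) - (F 0 +i* G 0)); split; first by rewrite subrr.
move=> x; apply: (@cder_eq _ _ _ (f x - 0)); last by rewrite subr0.
by apply: cderB; [split; [exact: hF|exact: hG]|exact: cder_cst].
Qed.

Lemma periodic_bounded f (L : R) : 0 < L -> continuous f ->
  (forall x, f (x + L) = f x) -> exists M, forall x, `|f x| <= M.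
Proof.
move=> L0 cf pf.
have pZ (n : int) x : f (x + n%:~R * L) = f x.
  elim/int_rect: n x => [|n IH|n IH] x; first by rewrite mul0r addr0.
  - by rewrite -addn1 PoszD intrD mulrDl mul1r addrA pf IH.
  - rewrite -pf -[RHS]IH; congr f.
    by rewrite -addn1 PoszD opprD intrD mulrDl mulN1r addrA subrK.
have [c _ hc] := @EVT_max R (fun x => `|f x|) 0 L (ltW L0)
  (continuous_subspaceT (fun x => continuous_comp (cf x) (@norm_continuous _ _ _))).
exists `|f c| => x.
rewrite -(pZ (- Num.floor (x / L)) x); apply: hc.
rewrite in_itv /= rmorphN /= mulNr.
have /andP[h1 h2] := Num.Theory.floor_itv (x / L).
have E : x / L * L = x by rewrite divfK // lt0r_neq0.
have := ler_wpM2r (ltW L0) h1; have := ltW h2; rewrite intrD.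
by move=> /(ler_wpM2r (ltW L0)); rewrite mulrDl E mul1r => *; apply/andP; split; lra.
Qed.

End Antiderivatives.

(** * Bloch modes from the Lax pair *)

Section Bounded.
Context {R : realType}.
Implicit Types f g : R -> R[i].

Definition cbounded f := exists M : R, forall x, absC (f x) <= M.

Lemma cbounded_cst a : cbounded (fun=> a).
Proof. by exists (absC a). Qed.

Lemma cboundedD f g : cbounded f -> cbounded g -> cbounded (fun x => f x + g x).
Proof.
move=> [M hM] [N hN]; exists (M + N) => x.
exact: le_trans (absCD _ _) (lerD _ _).
Qed.

Lemma cboundedM f g : cbounded f -> cbounded g -> cbounded (fun x => f x * g x).
Proof.
move=> [M hM] [N hN]; exists (M * N) => x.
by rewrite absCM ler_pM ?absC_ge0.
Qed.

Lemma cboundedN f : cbounded f -> cbounded (fun x => - f x).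
Proof. by move=> [M hM]; exists M => x; rewrite absCN. Qed.

Lemma cboundedJ f : cbounded f -> cbounded (fun x => cj (f x)).
Proof. by move=> [M hM]; exists M => x; rewrite absCJ. Qed.

Lemma cboundedX f n : cbounded f -> cbounded (fun x => f x ^+ n).
Proof.
move=> [M hM]; exists (M ^+ n) => x; rewrite absCX.
have M0 : 0 <= M := le_trans (absC_ge0 _) (hM 0).
by apply: lerXn2r; rewrite ?nnegrE ?absC_ge0.
Qed.

Lemma absC_periodic_bounded f (df : R -> R[i]) (L : R) : 0 < L ->
  (forall x, cder f x (df x)) ->
  (forall x, absC (f (x + L)) = absC (f x)) -> cbounded f.
Proof.
move=> L0 hf pf.
have [||M hM] := @periodic_bounded R (fun x => absC (f x) ^+ 2) L L0.
- have -> : (fun x => absC (f x) ^+ 2) =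
    (fun x => (reC \o f) x * (reC \o f) x + (imC \o f) x * (imC \o f) x).
    by apply/funext => x /=; rewrite absC_sqr !expr2.
  move=> x; have [fr fi] := hf x.
  exact: rder_continuous (rderD (rderM fr fr) (rderM fi fi)).
- by move=> x; rewrite pf.
exists (M + 1) => x.
have := hM x; rewrite ger0_norm ?sqr_ge0 // => h.
by have := absC_ge0 (f x); nra.
Qed.

End Bounded.

Section Modes.
Context {R : realType}.
Implicit Types W : R -> R[i].

Definition profile W W1 := forall x, cder W x (W1 x) /\
  cder W1 x (- W x - W x * cj (W x) * W x).

(** A perturbation of W and its complex conjugate become independent functions v
    and w in the complexification.  The lower bound on v serves to compare the
    errors that a cutoff produces with the truncated mode itself. *)
Definition bloch_mode W (lambda : R[i]) (v v1 w w1 : R -> R[i]) :=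
  [/\ forall x, cder v x (v1 x) /\ cder w x (w1 x),
      forall x, cder v1 x
        (- (1 + iC * lambda + 2 * (W x * cj (W x))) * v x - W x ^+ 2 * w x),
      forall x, cder w1 x
        (- (1 - iC * lambda + 2 * (W x * cj (W x))) * w x - cj (W x) ^+ 2 * v x),
      [/\ cbounded v, cbounded v1, cbounded w & cbounded w1] &
      exists2 c : R, 0 < c & forall x, c <= absC (v x)].

Definition unstable_mode W := exists (lambda : R[i]) (v v1 w w1 : R -> R[i]),
  0 < reC lambda /\ bloch_mode W lambda v v1 w w1.

Lemma cder_reflect (f : R -> R[i]) x a :
  cder f (- x) a -> cder (fun y => f (- y)) x (- a).
Proof.
move=> h; have := @cder_comp_lin R f (-1) 0 x a.
rewrite mulN1r addr0 => /(_ h); rewrite rmorphN mulN1r.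
by apply: cder_ext => y; rewrite mulN1r addr0.
Qed.

Lemma profile_reflect W W1 : profile W W1 ->
  profile (fun x => W (- x)) (fun x => - W1 (- x)).
Proof.
move=> h x; have [h0 h1] := h (- x); split; first exact: cder_reflect.
by apply: (cder_eq (cderN (cder_reflect h1))); ring.
Qed.

Lemma unstable_mode_reflect W : unstable_mode (fun x => W (- x)) -> unstable_mode W.
Proof.
move=> [l [v [v1 [w [w1 [l0 [h0 hv hw [bv bv1 bw bw1] [c c0 hc]]]]]]]].
exists l, (fun x => v (- x)), (fun x => - v1 (- x)),
  (fun x => w (- x)), (fun x => - w1 (- x)); split => //; split.
- by move=> x; have [? ?] := h0 (- x); split; exact: cder_reflect.
- by move=> x; apply: (cder_eq (cderN (cder_reflect (hv (- x))))); rewrite /= !opprK.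
- by move=> x; apply: (cder_eq (cderN (cder_reflect (hw (- x))))); rewrite /= !opprK.
- have nb f : cbounded f -> cbounded (fun x => f (- x)).
    by move=> [M hM]; exists M => x.
  by split; try apply: cboundedN; exact: nb.
- by exists c.
Qed.

Section LaxPair.
Variables (W W1 : R -> R[i]) (zeta : R[i]).
Hypothesis ode : profile W W1.

(** The entries of the matrix T of the Lax pair psi_x = X psi, psi_t = T psi at
    the potential W / sqrt 2, in the frame in which the wave is stationary; B and
    C are multiplied by sqrt 2.  The derivatives below express the
    compatibility condition T' = [X, T], which makes - det T = laxdet constant. *)
Definition laxA x : R[i] := - 2 * iC * zeta ^+ 2 + iC / 2 + iC / 2 * (W x * cj (W x)).
Definition laxB x : R[i] := 2 * zeta * W x + iC * W1 x.
Definition laxC x : R[i] := - 2 * zeta * cj (W x) + iC * cj (W1 x).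
Definition laxdet x : R[i] := laxA x ^+ 2 + laxB x * laxC x / 2.

Let J2 : (iC : R[i]) ^+ 2 = -1 := iC2.

Lemma cder_W x : cder W x (W1 x). Proof. by have [] := ode x. Qed.
Lemma cder_W1 x : cder W1 x (- W x - W x * cj (W x) * W x).
Proof. by have [] := ode x. Qed.

Lemma cder_laxA x :
  cder laxA x (iC / 2 * (W1 x * cj (W x) + W x * cj (W1 x))).
Proof.
apply: (cder_eq (cderD (cder_cst _ x)
  (cderZ (iC / 2) (cderM (cder_W x) (cder_conj (cder_W x)))))).
by rewrite add0r.
Qed.

Lemma cder_laxB x : cder laxB x (- 2 * iC * zeta * laxB x - 2 * laxA x * W x).
Proof.
apply: (cder_eq (cderD (cderZ (2 * zeta) (cder_W x)) (cderZ iC (cder_W1 x)))).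
by rewrite /laxA /laxB; field: J2.
Qed.

Lemma cder_laxC x : cder laxC x (2 * iC * zeta * laxC x - 2 * laxA x * cj (W x)).
Proof.
apply: (cder_eq (cderD (cderZ (- 2 * zeta) (cder_conj (cder_W x)))
  (cderZ iC (cder_conj (cder_W1 x))))).
by rewrite rmorphB rmorphN !rmorphM /= conjcK /laxA /laxC; field: J2.
Qed.

Lemma laxdet_cst x y : laxdet x = laxdet y.
Proof.
apply: cder0_cst => t; rewrite /laxdet.
apply: (cder_ext (f := fun y => laxA y * laxA y + laxB y * laxC y * 2^-1)).
  by move=> u; rewrite expr2.
have hA := cderM (cder_laxA t) (cder_laxA t).
have hBC := cderM (cderM (cder_laxB t) (cder_laxC t)) (cder_cst 2^-1 t).
by apply: (cder_eq (cderD hA hBC)); rewrite /laxB /laxC; field: J2.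
Qed.

Lemma laxdet_near_half (s : R[i]) x : zeta = 2^-1 + s ->
  laxdet x = - 4 * s ^+ 2 * (1 + s) ^+ 2 - iC * s * (cj (W x) * W1 x - W x * cj (W1 x))
    - (W x + iC * W1 x) * cj (W x + iC * W1 x) / 2 - (W x * cj (W x)) ^+ 2 / 4.
Proof.
move=> h; rewrite conjCD conjCM conj_iC /laxdet /laxA /laxB /laxC h.
set w := W x; set w1 := W1 x; set wb := cj w; set wb1 := cj w1.
by field: J2.
Qed.

End LaxPair.

Section BlochMode.
Variables (W W1 : R -> R[i]) (zeta c : R[i]) (L : R) (F : R -> R[i]).
Hypotheses (ode : profile W W1) (L0 : 0 < L) (c1 : absC c = 1)
  (Wper : forall x, W (x + L) = c * W x)
  (B0 : forall x, laxB W W1 zeta x != 0)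
  (dF : forall x, cder F x (W x / laxB W W1 zeta x)) (F0 : F 0 = 0).

Let B := laxB W W1 zeta.
Let A := laxA W zeta.
Let J2 : (iC : R[i]) ^+ 2 = -1 := iC2.

Lemma W1per x : W1 (x + L) = c * W1 x.
Proof.
apply: (@cder_unique _ (fun y => c * W y) x); last exact/cderZ/(cder_W ode).
apply: (cder_ext (f := fun y => W (1 * y + L))).
  by move=> y; rewrite mul1r Wper.
apply: (cder_eq (@cder_comp_lin R W 1 L x (W1 (x + L)) _)).
  by rewrite mul1r; exact: (cder_W ode).
by rewrite mul1r.
Qed.

Lemma laxBper x : laxB W W1 zeta (x + L) = c * laxB W W1 zeta x.
Proof. by rewrite /laxB Wper W1per; ring. Qed.

(** The primitive F of W / B is the sum of a periodic function and of a linear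
    function with slope F(L) / L, the mean of W / B. *)
Lemma F_shift x : F (x + L) = F x + F L.
Proof.
have h t : cder (fun y => F (1 * y + L) - F y) t 0.
  have := cderB (@cder_comp_lin R F 1 L t _ (dF (1 * t + L))) (dF t).
  move=> h; apply: (cder_eq h); rewrite !mul1r Wper laxBper.
  rewrite -mulf_div divff ?mul1r ?subrr //.
  by apply: absC_neq0; rewrite c1.
have := cder0_cst h x 0; rewrite mul1r mulr0 add0r F0 subr0 => <-.
by rewrite [RHS]addrC subrK.
Qed.

(** Along an orbit of the Lax pair B and Omega - A are the two components of an
    eigenvector of the second Lax matrix; the exponential normalizes it to a
    solution psi of the first Lax equation, and (v, w) is, up to sign and
    scaling, the pair of squares of the components of psi.  The hypothesis
    on F(L) keeps the modulus of the exponential bounded. *)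
Lemma bloch_mode_of_lax (Omega : R[i]) :
  Omega ^+ 2 = laxdet W W1 zeta 0 -> reC (Omega * F L) = 0 ->
  exists v v1 w w1, bloch_mode W (2 * Omega) v v1 w w1.
Proof.
move=> Om2 OmF.
pose C := laxC W W1 zeta.
have Om2x x : Omega ^+ 2 = A x ^+ 2 + B x * C x / 2.
  by rewrite Om2 (laxdet_cst zeta ode 0 x).
pose E x := cexp (2 * Omega * F x).
pose v x := B x * E x.
pose g x := (Omega - A x) * E x.
pose s x := 2 * (Omega - A x) ^+ 2 / B x * E x.
have dE x : cder E x (2 * Omega * (W x / B x) * E x).
  exact: (cder_cexp (cderZ (2 * Omega) (dF x))).
have CE x : C x = 2 * (Omega ^+ 2 - A x ^+ 2) / B x.
  by rewrite (Om2x x); field; exact: B0.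
(* v, g and s are proportional to psi_1^2, psi_1 psi_2 and psi_2^2, and satisfy
   a linear system of first order. *)
have A1 x : iC / 2 * (W1 x * cj (W x) + W x * cj (W1 x)) =
    (W x * C x + cj (W x) * B x) / 2.
  by rewrite /C /B /laxC /laxB; field.
have dv x : cder v x (- 2 * iC * zeta * v x + 2 * W x * g x).
  apply: (cder_eq (cderM (cder_laxB zeta ode x) (dE x))).
  by rewrite /v /g -/(B x) -/(A x); field; exact: B0.
have dg x : cder g x (W x * s x / 2 - cj (W x) * v x / 2).
  apply: (cder_eq (cderM (cderB (cder_cst Omega x) (cder_laxA zeta ode x)) (dE x))).
  rewrite A1 CE /s /v -/(A x); field; exact: B0.
have ds x : cder s x (2 * iC * zeta * s x - 2 * cj (W x) * g x).
  have dG := cderB (cder_cst Omega x) (cder_laxA zeta ode x).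
  have dB1 := cderV (B0 x) (cder_laxB zeta ode x).
  have := cderM (cderM (cderZ 2 (cderM dG dG)) dB1) (dE x).
  have -> : (fun y => 2 * ((Omega - laxA W zeta y) * (Omega - laxA W zeta y)) *
     (laxB W W1 zeta y)^-1 * E y) = s.
    by apply/funext => y; rewrite /s expr2.
  move=> h; apply: (cder_eq h).
  rewrite A1 CE /s /g -/(A x) -/(B x); field; exact: B0.
exists v, (fun x => - 2 * iC * zeta * v x + 2 * W x * g x),
  (fun x => - s x), (fun x => - (2 * iC * zeta * s x - 2 * cj (W x) * g x)).
have bW : cbounded W.
  apply: (absC_periodic_bounded L0 (cder_W ode)) => x.
  by rewrite Wper absCM c1 mul1r.
have bB : cbounded B.
  apply: (absC_periodic_bounded L0 (cder_laxB zeta ode)) => x.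
  by rewrite /B laxBper absCM c1 mul1r.
have bBi : cbounded (fun x => (B x)^-1).
  apply: (absC_periodic_bounded L0 (fun x => cderV (B0 x) (cder_laxB zeta ode x))) => x.
  by rewrite laxBper !absCV absCM c1 mul1r.
have bA : cbounded A.
  apply: cboundedD; first exact: cbounded_cst.
  by apply: cboundedM; [exact: cbounded_cst|exact: cboundedM bW (cboundedJ bW)].
have [K hK] : cbounded (fun x => F x - (F L / L%:C) * x%:C).
  apply: (absC_periodic_bounded L0 (fun x => cderB (dF x)
    (cderZ _ (cder_real (is_derive_id x 1))))) => x.
  rewrite F_shift rmorphD /=; congr absC.
  have L1 : L%:C != 0 by rewrite fmorph_eq0 lt0r_neq0.
  by field.
pose K2 := 2 * absC Omega * K.
have hE x : `|reC (2 * Omega * F x)| <= K2.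
  have -> : reC (2 * Omega * F x) =
      reC (2 * Omega * (F x - (F L / L%:C) * x%:C)).
    rewrite mulrBr reCD reCN.
    have -> : 2 * Omega * (F L / L%:C * x%:C) = (2 * x / L)%:C * (Omega * F L).
      rewrite !rmorphM fmorphV /= rmorph_nat; field.
      by rewrite fmorph_eq0 lt0r_neq0.
    by rewrite [reC (_ * (Omega * _))]reCM OmF /= mulr0 mul0r !subr0.
  apply: (le_trans (ler_reC _)).
  rewrite !absCM absC_nat /K2.
  by apply: ler_wpM2l => //; rewrite mulr_ge0 ?absC_ge0.
have bE : cbounded E.
  exists (expR K2) => x; rewrite absC_cexp ler_expR.
  exact: le_trans (ler_norm _) (hE x).
have bv : cbounded v by exact: cboundedM.
have bG : cbounded (fun x => Omega - A x).
  by apply: cboundedD; [exact: cbounded_cst|exact: cboundedN].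
have bg : cbounded g by exact: cboundedM.
have bs : cbounded s.
  apply: cboundedM => //; apply: cboundedM => //; apply: cboundedM; first exact: cbounded_cst.
  exact: cboundedX.
have Bg x : B x * g x = (Omega - A x) * v x by rewrite /g /v; ring.
have Cg x : C x * g x = (Omega + A x) * s x.
  by rewrite CE /g /s; field; exact: B0.
split.
- by move=> x; split; [exact: dv|exact: cderN].
- move=> x.
  have := cderD (cderZ (- 2 * iC * zeta) (dv x))
     (cderM (cderZ 2 (cder_W ode x)) (dg x)).
  move=> h; apply: (cder_eq h).
  rewrite [LHS](_ : _ = - 4 * zeta ^+ 2 * v x - 2 * iC * (B x * g x)
    + W x ^+ 2 * s x - W x * cj (W x) * v x); last first.
    by rewrite /B /laxB; field: J2.
  by rewrite Bg /A /laxA; field: J2.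
- move=> x.
  have := cderN (cderB (cderZ (2 * iC * zeta) (ds x))
     (cderM (cderZ 2 (cder_conj (cder_W ode x))) (dg x))).
  move=> h; apply: (cder_eq h).
  rewrite [LHS](_ : _ = 4 * zeta ^+ 2 * s x - 2 * iC * (C x * g x)
    + W x * cj (W x) * s x - cj (W x) ^+ 2 * v x); last first.
    by rewrite /C /laxC; field: J2.
  by rewrite Cg /A /laxA; field: J2.
- split => //.
  + apply: cboundedD; apply: cboundedM => //; try exact: cbounded_cst.
    by apply: cboundedM => //; exact: cbounded_cst.
  + exact: cboundedN.
  + apply: cboundedN; apply: cboundedD; first by apply: cboundedM => //; exact: cbounded_cst.
    apply: cboundedN; apply: cboundedM => //; apply: cboundedM; first exact: cbounded_cst.
    exact: cboundedJ.
- have [M hM] := bBi.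
  have M0 : 0 < M.
    apply: lt_le_trans (hM 0); rewrite absCV invr_gt0 lt_def absC_ge0 andbT.
    by rewrite absC_eq0 B0.
  exists (M^-1 * expR (- K2)); first by rewrite mulr_gt0 ?invr_gt0 ?expR_gt0.
  move=> x; rewrite absCM absC_cexp; apply: ler_pM; rewrite ?expR_ge0 ?invr_ge0 ?(ltW M0) //.
    rewrite -[absC (B x)]invrK -absCV lef_pV2 ?posrE //.
    by rewrite absCV invr_gt0 lt_def absC_ge0 andbT absC_eq0 B0.
  by rewrite ler_expR; have := hE x; rewrite ler_norml => /andP[].
Qed.

(** The relation Re(Omega F(L)) = 0 puts Omega on the line i R / F(L), which
    meets the right half-plane as soon as F(L) is not real; Omega and
    - Omega are equally admissible, so the sign is free. *)
Lemma unstable_mode_of_lax : imC (F L) != 0 ->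
  imC (laxdet W W1 zeta 0 * F L ^+ 2) = 0 ->
  reC (laxdet W W1 zeta 0 * F L ^+ 2) < 0 -> unstable_mode W.
Proof.
set f := F L; set D := _ * _ => imf imD reD.
have f0 : f != 0 by apply: contraNneq imf => ->.
(* The sign of tau makes the real part of Omega positive. *)
pose tau := Num.sg (imC f) * Num.sqrt (- reC D).
have tau2 : tau ^+ 2 = - reC D.
  by rewrite exprMn sqr_sqrtr ?oppr_ge0 ?ltW // sqr_sg imf mul1r.
pose Omega := iC * tau%:C / f.
have DE : D = (reC D)%:C by move: imD; case: (D) => u w; rewrite /imC /= => ->.
have Om2 : Omega ^+ 2 = laxdet W W1 zeta 0.
  have -> : laxdet W W1 zeta 0 = D / f ^+ 2 by rewrite /D mulfK // expf_neq0.
  by rewrite DE -[reC D]opprK -tau2 rmorphN rmorphXn /= /Omega; field: J2.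
have OmF : reC (Omega * f) = 0.
  by rewrite /Omega divfK // reCM /= mulr0 mul0r subrr.
have [v [v1 [w [w1 h]]]] := bloch_mode_of_lax Om2 OmF.
exists (2 * Omega), v, v1, w, w1; split => //.
have -> : 2 * Omega = (2 * tau / absC f ^+ 2)%:C * (iC * cj f).
  rewrite (_ : (_ / _)%:C = 2 * tau%:C / (f * cj f)).
    by rewrite /Omega; field; rewrite f0 conjc_eq0 f0.
  by rewrite mulCJ fmorph_div rmorphM rmorph_nat.
rewrite [iC * _](_ : _ = imC f +i* reC f); last first.
  by case: (f) => a b; apply: eq_reim; rewrite ?reCM ?imCM /=; ring.
rewrite reCM /= mul0r subr0 /tau.
have -> : 2 * (Num.sg (imC f) * Num.sqrt (- reC D)) / absC f ^+ 2 * imC f =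
  2 * `|imC f| * Num.sqrt (- reC D) / absC f ^+ 2.
  by rewrite [`|_|]normrEsg; ring.
apply: divr_gt0; first by rewrite !mulr_gt0 ?normr_gt0 ?sqrtr_gt0 ?oppr_gt0.
by rewrite exprn_gt0 // lt_def absC_ge0 absC_eq0 f0.
Qed.

End BlochMode.
End Modes.

(** * Existence of an unstable Bloch mode for small waves *)

Section AbsBounds.
Context {R : realType}.
Implicit Types (x y : R[i]) (p q : R).

Lemma absC_leD x y p q : absC x <= p -> absC y <= q -> absC (x + y) <= p + q.
Proof. by move=> hx hy; exact: le_trans (absCD _ _) (lerD hx hy). Qed.

Lemma absC_leN x p : absC x <= p -> absC (- x) <= p.
Proof. by rewrite absCN. Qed.

Lemma absC_leB x y p q : absC x <= p -> absC y <= q -> absC (x - y) <= p + q.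
Proof. by move=> hx hy; apply: absC_leD => //; exact: absC_leN. Qed.

Lemma absC_leM x y p q : absC x <= p -> absC y <= q -> absC (x * y) <= p * q.
Proof. by move=> hx hy; rewrite absCM ler_pM ?absC_ge0. Qed.

Lemma absC_geB x y p q : p <= absC x -> absC y <= q -> p - q <= absC (x + y).
Proof.
move=> hx hy; rewrite lerBlDr (le_trans hx) //.
by rewrite -{1}(addrK y x) (le_trans (absCB _ _)) // lerD2l.
Qed.

Lemma absC_leV x p : 0 < p -> p <= absC x -> absC x^-1 <= p^-1.
Proof.
by move=> p0 hx; rewrite absCV lef_pV2 ?posrE // (lt_le_trans p0).
Qed.

Lemma absC_expi_sub1 (t : R) : absC (expi t - 1) <= 2 * `|t|.
Proof.
have h : forall x : R, cder (fun y : R => expi (1 * y + 0)) x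
    ((1 : R)%:C * (iC * expi (1 * x + 0))) by move=> x; exact: cder_expi.
have := @cder_lip R (fun y : R => expi (1 * y + 0)) _ 1 0 t h.
rewrite mulr0 !addr0 mul1r expi0 subr0 mulr1; apply => x.
by rewrite !absCM absC_real absC_iC absC_expi normr1 !mulr1.
Qed.

End AbsBounds.

Section Estimates.
Context {R : realType}.
Variables (W W1 : R -> R[i]) (l k a b K : R) (c : R[i]).
Let rho : R := `|a|.
(* Leading terms: W is close to a em + b ep, and W + i W' to 2 a em. *)
Let em x : R[i] := expi ((l - k) * x).
Let ep x : R[i] := expi ((l + k) * x).
Hypotheses (ode : profile W W1) (a0 : a != 0) (K1 : 1 <= K)
  (smallK : rho * (6000 * K) <= 1) (ba : `|b| <= `|a|)
  (hl : `|l| <= rho ^+ 2) (hk : `|k - 1| <= 2 * rho ^+ 2)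
  (c1 : absC c = 1) (Wper : forall x, W (x + pi / k) = c * W x)
  (Wapprox : forall x,
    absC (W x - (a%:C * em x + b%:C * ep x)) <= K * rho ^+ 3).

(* Relative errors are multiples of q; the factor 6000 above makes them small
   compared with rho. *)
Let q := K * rho ^+ 2.

Let rho_gt0 : 0 < rho. Proof. by rewrite normr_gt0. Qed.
Let q_le : q * 6000 <= rho. Proof. by rewrite /q; move: rho_gt0 smallK; nra. Qed.
Let rho2_le : rho ^+ 2 <= q. Proof. by rewrite /q; move: rho_gt0 K1; nra. Qed.
Let rho_le : rho * 6000 <= 1. Proof. by move: rho_gt0 K1 smallK; nra. Qed.
Let q_ge0 : 0 <= q. Proof. by apply: le_trans rho2_le; exact: sqr_ge0. Qed.
Let J2 : (iC : R[i]) ^+ 2 = -1 := iC2.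

Let ka : 0 < k.
Proof. by have := ler_norm (1 - k); rewrite distrC; move: hk rho2_le q_le rho_le; lra. Qed.

Let Wapx x : absC (W x - (a%:C * em x + b%:C * ep x)) <= q * rho.
Proof. by apply: le_trans (Wapprox x) _; rewrite /q -mulrA -exprSr. Qed.

Let aem x : absC (a%:C * em x) <= rho.
Proof. by rewrite absCM absC_real absC_expi mulr1. Qed.

Let bep x : absC (b%:C * ep x) <= rho.
Proof. by rewrite absCM absC_real absC_expi mulr1. Qed.

Lemma W_le x : absC (W x) <= 3 * rho.
Proof.
rewrite -(subrK (a%:C * em x + b%:C * ep x) (W x)).
apply: le_trans (absC_leD (Wapx x) (absC_leD (aem x) (bep x))) _.
by move: q_le rho_le rho_gt0 q_ge0; nra.
Qed.

Let cube_le x : absC (W x * cj (W x) * W x) <= 27 * rho ^+ 3.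
Proof.
have h := W_le x; have h' : absC (cj (W x)) <= 3 * rho by rewrite absCJ.
by apply: le_trans (absC_leM (absC_leM h h') h) _; lra.
Qed.

Let pi_le4 : pi <= 4 :> R.
Proof. by have := @pihalf_lt2 R; rewrite ltr_pdivrMr // => /ltW; rewrite -natrM. Qed.

(** Up to the integral of g, the solution is carried by the rotation
    exp(i sg x). *)
Lemma quarter_turn (sg : R) (f g : R -> R[i]) (r : R) :
  (forall x, cder f x (sg%:C * iC * f x + g x)) -> (forall x, absC (g x) <= r) ->
  forall x, absC (expi (- sg * (pi / 2)) * f (x + pi / 2) - f x) <= 4 * r.
Proof.
move=> hf hg x.
pose h y := expi (- sg * y + 0) * f y.
have hh y : cder h y (expi (- sg * y + 0) * g y).
  apply: (cder_eq (cderM (cder_expi (- sg) 0 y) (hf y))).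
  by rewrite rmorphN; ring.
have := @cder_lip R h _ r x (x + pi / 2) hh.
have -> : h (x + pi / 2) - h x =
    expi (- sg * x) * (expi (- sg * (pi / 2)) * f (x + pi / 2) - f x).
  by rewrite /h !addr0 mulrDr expiD; ring.
rewrite absCM absC_expi mul1r (addrC x) addrK ger0_norm; last first.
  by rewrite divr_ge0 ?pi_ge0.
move=> H; apply: le_trans (H _) _; first by move=> t; rewrite absCM absC_expi mul1r.
have r0 : 0 <= r := le_trans (absC_ge0 _) (hg 0).
by move: pi_le4; nra.
Qed.

Let expi_pihalf : expi (pi / 2) = iC :> R[i].
Proof. by apply: eq_reim; rewrite /= ?cos_pihalf ?sin_pihalf. Qed.

Let expiN_pihalf : expi (- (pi / 2)) = - iC :> R[i].
Proof. by apply: eq_reim; rewrite /= ?cosN ?sinN ?cos_pihalf ?sin_pihalf ?oppr0. Qed.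

(** W + i W' and W - i W' rotate like exp(-ix) and exp(ix) up to cubic terms, so
    both are determined by the values of W at x and x + pi / 2: the derivative is
    controlled by the size of W - a em - b ep alone. *)
Lemma B0_approx x : absC (W x + iC * W1 x - 2 * a%:C * em x) <= 134 * q * rho.
Proof.
have dB y : cder (fun y => W y + iC * W1 y) y
    ((-1)%:C * iC * (W y + iC * W1 y) + (- iC * (W y * cj (W y) * W y))).
  apply: (cder_eq (cderD (cder_W ode y) (cderZ iC (cder_W1 ode y)))).
  by rewrite rmorphN rmorph1; ring: J2.
have dN y : cder (fun y => W y - iC * W1 y) y
    ((1)%:C * iC * (W y - iC * W1 y) + (iC * (W y * cj (W y) * W y))).
  apply: (cder_eq (cderB (cder_W ode y) (cderZ iC (cder_W1 ode y)))).
  by rewrite rmorph1; ring: J2.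
have gB y : absC (- iC * (W y * cj (W y) * W y)) <= 27 * rho ^+ 3.
  by rewrite absCM absCN absC_iC mul1r.
have gN y : absC (iC * (W y * cj (W y) * W y)) <= 27 * rho ^+ 3.
  by rewrite absCM absC_iC mul1r.
have hB := quarter_turn dB gB x; have hN := quarter_turn dN gN x.
move: hB hN; rewrite opprK mul1r mulN1r expi_pihalf expiN_pihalf => hB hN.
pose x' := x + pi / 2.
have emE : iC * em x' = em x * expi ((l - k + 1) * (pi / 2)).
  rewrite /em -expi_pihalf -!expiD; congr expi; rewrite /x'; ring.
have epE : iC * ep x' = - ep x * expi ((l + k - 1) * (pi / 2)).
  have -> : iC = - expi (- (pi / 2)) :> R[i] by rewrite expiN_pihalf opprK.
  rewrite !mulNr /ep -!expiD; congr (- expi _); rewrite /x'; ring.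
have small (t : R) : `|t| <= 3 * q -> absC (expi (t * (pi / 2)) - 1) <= 12 * q.
  move=> ht; apply: (le_trans (absC_expi_sub1 _)).
  rewrite normrM (ger0_norm (_ : 0 <= pi / 2)) ?divr_ge0 ?pi_ge0 //.
  by have := normr_ge0 t; have := pi_ge0 R; move: pi_le4; nra.
have sm : absC (expi ((l - k + 1) * (pi / 2)) - 1) <= 12 * q.
  apply: small; rewrite (_ : l - k + 1 = l - (k - 1)); last by ring.
  by apply: (le_trans (ler_normB _ _)); move: hl hk rho2_le; lra.
have sp : absC (expi ((l + k - 1) * (pi / 2)) - 1) <= 12 * q.
  apply: small; rewrite -addrA.
  by apply: (le_trans (ler_normD _ _)); move: hl hk rho2_le; lra.
have Wx := Wapx x; have Wx' := absC_leM (lexx (absC (iC : R[i]))) (Wapx x').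
rewrite (_ : _ - _ =
  - ((iC * (W x' + iC * W1 x') - (W x + iC * W1 x)) -
     (- iC * (W x' - iC * W1 x') - (W x - iC * W1 x))) / 2
  + (W x - (a%:C * em x + b%:C * ep x))
  + iC * (W x' - (a%:C * em x' + b%:C * ep x'))
  + a%:C * em x * (expi ((l - k + 1) * (pi / 2)) - 1)
  - b%:C * ep x * (expi ((l + k - 1) * (pi / 2)) - 1)); last first.
  rewrite [iC * (_ - _)](_ : _ = iC * W x' - (a%:C * (iC * em x') + b%:C * (iC * ep x'))); last by ring.
  by rewrite emE epE; field: J2.
have half : absC (2^-1 : R[i]) <= 2^-1 by rewrite absCV absC_nat.
apply: le_trans (absC_leB (absC_leD (absC_leD (absC_leD
  (absC_leM (absC_leN (absC_leB hB hN)) half) Wx) Wx')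
  (absC_leM (aem x) sm)) (absC_leM (bep x) sp)) _.
rewrite absC_iC; move: q_ge0 rho2_le rho_gt0.
have := ler_wpM2r (ltW rho_gt0) rho2_le; lra.
Qed.

Section FixedParameter.
Variable t : R.
Hypothesis t1 : `|t| <= 1.
Let s : R[i] := rho%:C * (t +i* 2^-1).
Let B := laxB W W1 (2^-1 + s).
Let E x : R[i] := expi (2 * k * x).
Let u x : R[i] := 1 + (b / a)%:C * E x.

Let s_le : absC s <= 3 / 2 * rho.
Proof.
rewrite absCM absC_real (ger0_norm (ltW rho_gt0)) mulrC.
apply: ler_wpM2r; first exact: ltW.
apply: (le_trans (absC_le_reim _)) => /=.
rewrite (ger0_norm (_ : 0 <= 2^-1)) ?invr_ge0 //; move: t1; lra.
Qed.

Let u_le x : absC (u x) <= 2.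
Proof.
have h1 : absC (1 : R[i]) <= 1 by rewrite (absC_real 1) normr1.
apply: le_trans (absC_leD h1 (lexx _)) _.
rewrite absCM absC_real absC_expi mulr1 normrM normfV.
have : `|b| / `|a| <= 1 by rewrite ler_pdivrMr ?normr_gt0 // mul1r.
lra.
Qed.

Let aC0 : a%:C != 0 :> R[i]. Proof. by rewrite fmorph_eq0. Qed.
Let em0 x : em x != 0. Proof. by apply: absC_neq0; rewrite absC_expi. Qed.
Let a_em x : absC (a%:C * em x) = rho.
Proof. by rewrite absCM absC_real absC_expi mulr1. Qed.

(* Relative errors of the leading terms of W and W + i W'. *)
Let d1 x := W x / (a%:C * em x) - u x.
Let d2 x := (W x + iC * W1 x) / (2 * a%:C * em x) - 1.

Let d1_le x : absC (d1 x) <= q.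
Proof.
have -> : d1 x = (W x - (a%:C * em x + b%:C * ep x)) / (a%:C * em x).
  have -> : ep x = em x * E x.
    by rewrite /ep /em /E -expiD; congr expi; ring.
  rewrite /d1 /u fmorph_div /=; field; rewrite em0 /=; exact: aC0.
by rewrite absCM absCV a_em ler_pdivrMr.
Qed.

Let d2_le x : absC (d2 x) <= 67 * q.
Proof.
have -> : d2 x = (W x + iC * W1 x - 2 * a%:C * em x) / (2 * (a%:C * em x)).
  rewrite /d2; field; rewrite em0 /=; exact: aC0.
rewrite absCM absCV absCM a_em absC_nat ler_pdivrMr ?mulr_gt0 //.
by apply: le_trans (B0_approx x) _; lra.
Qed.

Let WE x : W x = a%:C * em x * (u x + d1 x).
Proof. rewrite /d1; field; rewrite em0 /=; exact: aC0. Qed.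

Let den x := 1 + d2 x + s * (u x + d1 x).
Let BE x : B x = 2 * (a%:C * em x) * den x.
Proof.
have -> : B x = (W x + iC * W1 x) + 2 * s * W x by rewrite /B /laxB; field.
rewrite {2}WE /den /d2; field; rewrite em0 /=; exact: aC0.
Qed.

Let den_ge x : 2^-1 <= absC (den x).
Proof.
have h1 : 1 <= absC (1 : R[i]) by rewrite (absC_real 1) normr1.
rewrite /den -addrA.
apply: le_trans (absC_geB h1 (absC_leD (d2_le x)
  (absC_leM s_le (absC_leD (u_le x) (d1_le x))))).
by move: q_le rho_le rho_gt0 q_ge0; nra.
Qed.

Lemma laxB_ge x : rho <= absC (B x).
Proof.
rewrite BE !absCM absC_nat absC_real absC_expi mulr1.
by have := den_ge x; move: rho_gt0; rewrite -/rho; nra.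
Qed.

Lemma laxB_neq0 x : B x != 0.
Proof. by apply: absC_neq0; exact: lt_le_trans (laxB_ge x). Qed.

Let ratio_approx x : absC (W x / B x - u x * (1 - s * u x) / 2) <= 300 * q.
Proof.
have den0 : den x != 0 by apply: absC_neq0; apply: lt_le_trans (den_ge x); rewrite invr_gt0.
have -> : W x / B x - u x * (1 - s * u x) / 2 =
    (s ^+ 2 * u x ^+ 3 + d1 x - u x * (1 - s * u x) * (d2 x + s * d1 x))
     * (den x)^-1 / 2.
  rewrite BE WE; move: den0; rewrite /den => den0; field.
  by rewrite den0 em0 aC0.
have h1 : absC (1 : R[i]) <= 1 by rewrite (absC_real 1) normr1.
have half : absC (2^-1 : R[i]) <= 2^-1 by rewrite absCV absC_nat.
have hi : absC (den x)^-1 <= 2.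
  by rewrite -[2]invrK; apply: absC_leV => //; rewrite invr_gt0.
have s2 : absC (s ^+ 2) <= (3 / 2 * rho) ^+ 2.
  by rewrite absCX lerXn2r ?nnegrE ?absC_ge0 //; move: rho_gt0; lra.
have u3 : absC (u x ^+ 3) <= 2 ^+ 3.
  by rewrite absCX lerXn2r ?nnegrE ?absC_ge0.
apply: le_trans (absC_leM (absC_leM (absC_leB (absC_leD (absC_leM s2 u3) (d1_le x))
  (absC_leM (absC_leM (u_le x) (absC_leB h1 (absC_leM s_le (u_le x))))
   (absC_leD (d2_le x) (absC_leM s_le (d1_le x))))) hi) half) _.
rewrite (_ : _ * 2 / 2 = (3 / 2 * rho) ^+ 2 * 2 ^+ 3 + q
   + 2 * (1 + 3 / 2 * rho * 2) * (67 * q + 3 / 2 * rho * q)); last by field.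
have rq : rho * q <= q / 6000 by move: rho_le q_ge0; nra.
have : rho * (rho * q) <= q / 6000.
  apply: le_trans rq; apply: ler_piMl; first by rewrite mulr_ge0 // ltW.
  by move: rho_le rho_gt0; lra.
move: rq.
by move: rho2_le q_ge0; lra.
Qed.

(** The oscillating terms of [u (1 - s u)] integrate to zero over the
    period, which leaves the mean value [1 - s]. *)
Lemma mean_approx F : (forall x, cder F x (W x / B x)) -> F 0 = 0 ->
  exists2 e : R[i], absC e <= 1200 * q &
    F (pi / k) = (pi / k / 2)%:C * (1 - s + e).
Proof.
move=> dF F0.
have k0 : k != 0 by rewrite lt0r_neq0.
have kC0 : k%:C != 0 :> R[i] by rewrite fmorph_eq0.
have i0 := @iC_neq0 R.
pose be : R[i] := (b / a)%:C.
pose G x : R[i] := (1 - s) / 2 * x%:C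
  + be * (1 - 2 * s) / (4 * iC * k%:C) * expi (2 * k * x + 0)
  - s * be ^+ 2 / (8 * iC * k%:C) * expi (4 * k * x + 0).
have dG x : cder G x (u x * (1 - s * u x) / 2).
  apply: (cder_eq (cderB (cderD (cderZ _ (cder_real (is_derive_id x 1)))
    (cderZ _ (cder_expi (2 * k) 0 x))) (cderZ _ (cder_expi (4 * k) 0 x)))).
  have -> : expi (4 * k * x + 0) = E x ^+ 2 :> R[i].
    by rewrite expr2 /E -expiD; congr expi; ring.
  rewrite addr0 -/(E x) /u -/be !rmorphM /= !rmorph_nat; field.
  by apply/and3P; split; [exact: aC0|exact: kC0|exact: i0].
have Gper : G (pi / k) - G 0 = (1 - s) / 2 * (pi / k)%:C.
  have e2 : expi (2 * k * (pi / k) + 0) = 1 :> R[i].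
    rewrite addr0 (_ : 2 * k * (pi / k) = pi *+ 2); last by rewrite -mulr_natl; field.
    by apply: eq_reim; rewrite /= ?cos2pi ?sin2pi.
  have e4 : expi (4 * k * (pi / k) + 0) = 1 :> R[i].
    rewrite (_ : 4 * k * (pi / k) + 0 = (2 * k * (pi / k) + 0) + (2 * k * (pi / k) + 0)); last by ring.
    by rewrite expiD e2 mulr1.
  by rewrite /G e2 e4 !mulr0 !addr0 expi0; ring.
have L0 : 0 < pi / k by rewrite divr_gt0 ?pi_gt0.
have := @cder_lip R _ _ (300 * q) 0 (pi / k) (fun x => cderB (dF x) (dG x)) ratio_approx.
rewrite F0 sub0r opprK subr0 (ger0_norm (ltW L0)) => H.
exists ((F (pi / k) - (1 - s) / 2 * (pi / k)%:C) / (pi / k / 2)%:C).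
  have L2 : 0 < pi / k / 2 by rewrite divr_gt0.
  rewrite absCM absCV absC_real (ger0_norm (ltW L2)) ler_pdivrMr //.
  rewrite -Gper.
  rewrite (_ : _ - _ = F (pi / k) - G (pi / k) + G 0); last by ring.
  by apply: le_trans H _; lra.
have LC : (pi / k)%:C != 0 :> R[i] by rewrite fmorph_eq0 lt0r_neq0.
rewrite (_ : (pi / k / 2)%:C = (pi / k)%:C / 2); last by rewrite fmorph_div rmorph_nat.
by move: LC; generalize ((pi / k)%:C : R[i]) => z z0; field.
Qed.

Lemma laxdet_approx : exists2 e : R[i], absC e <= 104 * rho &
  laxdet W W1 (2^-1 + s) 0 =
    (rho ^+ 2)%:C * (- (1 + 4 * t ^+ 2)%:C - 4 * iC * t%:C + e).
Proof.
pose B00 := W 0 + iC * W1 0.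
have hW := W_le 0.
have hWJ : absC (cj (W 0)) <= 3 * rho by rewrite absCJ.
have dB0 := B0_approx 0.
have hB0 : absC B00 <= 2 * rho + 134 * q * rho.
  rewrite -(subrK (2 * a%:C * em 0) B00) addrC; apply: absC_leD => //.
  by rewrite -mulrA absCM a_em absC_nat.
have hB0' : 2 * rho - 134 * q * rho <= absC B00.
  rewrite -(subrK (2 * a%:C * em 0) B00) [X in absC X]addrC; apply: absC_geB => //.
  by rewrite -mulrA absCM a_em absC_nat.
have hW1 : absC (W1 0) <= 6 * rho.
  have -> : W1 0 = - iC * (B00 - W 0) by rewrite /B00; ring: J2.
  rewrite absCM absCN absC_iC mul1r; apply: le_trans (absC_leB hB0 hW) _.
  by move: q_le rho_le rho_gt0 q_ge0; nra.
have hW1J : absC (cj (W1 0)) <= 6 * rho by rewrite absCJ.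
pose n := absC B00 ^+ 2 / 2 - 2 * rho ^+ 2.
have hn : absC (n%:C : R[i]) <= rho ^+ 3.
  rewrite absC_real /n.
  have h0 : 0 <= 134 * q * rho by move: q_ge0 rho_gt0; nra.
  have h : 134 * q * rho <= rho ^+ 2 / 40 by move: q_le rho_gt0; nra.
  move: hB0 hB0' h h0 rho_gt0 rho_le.
  set m := absC B00; set z := 134 * q * rho => h1 h2 h3 h4 h5 h6.
  have h7 : `|m - 2 * rho| <= z by rewrite ler_norml; apply/andP; split; lra.
  rewrite (_ : m ^+ 2 / 2 - 2 * rho ^+ 2 = (m - 2 * rho) * ((m + 2 * rho) / 2)); last by field.
  rewrite normrM [`|(_ + _) / 2|]ger0_norm; last by rewrite divr_ge0 // addr_ge0 ?absC_ge0 // mulr_ge0 // ltW.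
  apply: le_trans (ler_pM (normr_ge0 _) _ h7 (_ : (m + 2 * rho) / 2 <= 3 * rho)) _.
  - by rewrite divr_ge0 // addr_ge0 ?absC_ge0 // mulr_ge0 // ltW.
  - by nra.
  - by rewrite exprS; nra.
pose sg : R[i] := t +i* 2^-1.
have hsg : absC sg <= 3 / 2.
  apply: (le_trans (absC_le_reim _)) => /=.
  rewrite (ger0_norm (_ : 0 <= 2^-1)) ?invr_ge0 //; move: t1; lra.
have sgE : sg = t%:C + iC / 2.
  have -> : (2^-1 : R[i]) = (2^-1)%:C by rewrite fmorphV rmorph_nat.
  by apply: eq_reim; rewrite ?reCD ?imCD ?reCM ?imCM /=; ring.
pose X := cj (W 0) * W1 0 - W 0 * cj (W1 0).
have hX : absC X <= 36 * rho ^+ 2.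
  by apply: le_trans (absC_leB (absC_leM hWJ hW1) (absC_leM hW hW1J)) _; lra.
pose r : R[i] := rho%:C.
have r0 : r != 0 by rewrite fmorph_eq0 lt0r_neq0.
have hr : absC r <= rho by rewrite absC_real (ger0_norm (ltW rho_gt0)).
pose e3 := 8 * r ^+ 3 * sg ^+ 3 + 4 * r ^+ 4 * sg ^+ 4 + iC * (r * sg) * X
  + n%:C + (W 0 * cj (W 0)) ^+ 2 / 4.
have he3 : absC e3 <= 104 * rho ^+ 3.
  have pw (z : R[i]) (p : R) m : absC z <= p -> absC (z ^+ m) <= p ^+ m.
    by move=> h; rewrite absCX lerXn2r ?nnegrE ?absC_ge0 ?(le_trans (absC_ge0 z)).
  have n8 : absC (8 : R[i]) <= 8 by rewrite absC_nat.
  have n4 : absC (4 : R[i]) <= 4 by rewrite absC_nat.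
  have v4 : absC (4^-1 : R[i]) <= 4^-1 by rewrite absCV absC_nat.
  have i1 : absC (iC : R[i]) <= 1 by rewrite absC_iC.
  apply: le_trans (absC_leD (absC_leD (absC_leD (absC_leD
    (absC_leM (absC_leM n8 (pw _ _ 3 hr)) (pw _ _ 3 hsg))
    (absC_leM (absC_leM n4 (pw _ _ 4 hr)) (pw _ _ 4 hsg)))
    (absC_leM (absC_leM i1 (absC_leM hr hsg)) hX)) hn)
    (absC_leM (pw _ _ 2 (absC_leM hW hWJ)) v4)) _.
  have : rho ^+ 4 <= rho ^+ 3 / 6000.
    by rewrite (exprSr rho 3); have := exprn_gt0 3 rho_gt0; move: rho_le; nra.
  have := exprn_gt0 3 rho_gt0; lra.
exists (- e3 / r ^+ 2).
  rewrite mulNr absCN absCM absCV absCX absC_real (ger0_norm (ltW rho_gt0)).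
  rewrite ler_pdivrMr ?exprn_gt0 //; apply: le_trans he3 _.
  by rewrite -mulrA -exprS.
have -> : (- (1 + 4 * t ^+ 2)%:C - 4 * iC * t%:C) = - 4 * sg ^+ 2 - 2.
  rewrite sgE rmorphD rmorphM /= rmorph1 rmorph_nat rmorphXn /=.
  by field: J2.
rewrite (@laxdet_near_half _ W W1 _ s 0 (erefl _)) -/X -/B00 mulCJ.
have -> : (absC B00 ^+ 2)%:C = 2 * n%:C + 4 * r ^+ 2.
  have -> : absC B00 ^+ 2 = 2 * n + 4 * rho ^+ 2 by rewrite /n; field.
  by rewrite rmorphD (rmorphM _ 2 n) (rmorphM _ 4) !rmorph_nat rmorphXn.
rewrite rmorphXn -/r /s -/sg -/r /e3; field; exact: r0.
Qed.

(** With s = rho (t + i / 2) the product below is rho^2 (L / 2)^2 times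
    - 4 (t + i / 2)^2 - 2 = - (1 + 4 t^2) - 4 i t, up to a small error:
    its imaginary part changes sign between t = -1 and t = 1 while its real part
    stays negative. *)
Lemma lax_product_approx F : (forall x, cder F x (W x / B x)) -> F 0 = 0 ->
  exists (kap : R) (e : R[i]), [/\ 0 < kap, absC e <= 2^-1 &
    laxdet W W1 (2^-1 + s) 0 * F (pi / k) ^+ 2 =
    kap%:C * (- (1 + 4 * t ^+ 2)%:C - 4 * iC * t%:C + e)].
Proof.
move=> dF F0; have [e1 he1 ->] := mean_approx dF F0.
have [e2 he2 ->] := laxdet_approx.
set D := - _ - _; set L := pi / k / 2.
have L0 : 0 < L by rewrite !divr_gt0 ?pi_gt0.
exists (rho ^+ 2 * L ^+ 2), (e2 * (1 - s + e1) ^+ 2 + D * ((e1 - s) * (e1 - s) + 2 * (e1 - s))).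
split; first by rewrite mulr_gt0 ?exprn_gt0.
- have hes : absC (e1 - s) <= 2 * rho.
    apply: le_trans (absC_leB he1 s_le) _.
    by move: q_le rho_gt0; lra.
  have h1 : absC (1 : R[i]) <= 1 by rewrite (absC_real 1) normr1.
  have n2 : absC (2 : R[i]) <= 2 by rewrite absC_nat.
  have n4 : absC (4 : R[i]) <= 4 by rewrite absC_nat.
  have i1 : absC (iC : R[i]) <= 1 by rewrite absC_iC.
  have h1s : absC (1 - s + e1) <= 2.
    rewrite -addrA [- s + e1]addrC; apply: le_trans (absC_leD h1 hes) _.
    by move: rho_le; lra.
  have hD : absC D <= 5 + 4.
    apply: absC_leB; last first.
      by rewrite !absCM absC_nat absC_iC absC_real mulr1; move: t1; lra.
    rewrite absCN absC_real; have t20 := sqr_ge0 t.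
    rewrite ger0_norm; last by lra.
    have : t ^+ 2 <= 1 by move: t1; rewrite ler_norml => /andP[]; nra.
    by lra.
  rewrite expr2.
  apply: le_trans (absC_leD (absC_leM he2 (absC_leM h1s h1s))
   (absC_leM hD (absC_leD (absC_leM hes hes) (absC_leM n2 hes)))) _.
  by move: rho_le rho_gt0; nra.
- rewrite (rmorphM _ (rho ^+ 2)) (rmorphXn _ 2 L); ring.
Qed.

Lemma mean_im_neq0 F : (forall x, cder F x (W x / B x)) -> F 0 = 0 ->
  imC (F (pi / k)) != 0.
Proof.
move=> dF F0; have [e he ->] := mean_approx dF F0.
have L0 : 0 < pi / k / 2 by rewrite !divr_gt0 ?pi_gt0.
have i1 : imC (1 : R[i]) = 0 by [].
have is_ : imC s = rho / 2 by rewrite imCM /= mul0r addr0.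
rewrite imCM /= mul0r addr0; apply: mulf_neq0; first by rewrite lt0r_neq0.
apply/negbT/lt_eqF; rewrite !imCD imCN i1 is_.
have := le_trans (ler_norm _) (le_trans (ler_imC e) he).
by move: q_le rho_gt0; lra.
Qed.

End FixedParameter.

(** With t = sin y the estimates hold, and the product depends continuously on
    the parameter, for every real y; t runs from -1 to 1 as y runs from
    - pi / 2 to pi / 2. *)
Lemma unstable_mode_of_estimates : unstable_mode W.
Proof.
pose t (y : R) := sin y.
have t1 y : `|t y| <= 1 by rewrite ler_norml sin_geN1 sin_le1.
pose s y : R[i] := rho%:C * (t y +i* 2^-1).
pose z y := 2^-1 + s y.
pose B y := laxB W W1 (z y).
have B0 y x : B y x != 0 := laxB_neq0 (t1 y) x.
have hF y : exists F : R -> R[i], F 0 = 0 /\ forall x, cder F x (W x / B y x).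
  have dq x := cderM (cder_W ode x) (cderV (B0 y x) (cder_laxB (z y) ode x)).
  have [cr ci] := ccont_cder dq.
  by have [F [F0 dF]] := cantiderivative cr ci; exists F.
have {hF} [F hF] := choice hF.
have F0 y : F y 0 = 0 by have [] := hF y.
have dF y x : cder (F y) x (W x / B y x) by have [] := hF y.
pose L := pi / k.
have L0 : 0 < L by rewrite divr_gt0 ?pi_gt0.
pose phi y := laxdet W W1 (z y) 0 * F y L ^+ 2.
have tlip y y' : `|t y - t y'| <= 1 * `|y - y'|.
  by apply: (@rder_lip R sin cos) => u; rewrite ler_norml cos_geN1 cos_le1.
have cF : ccont (fun y => F y L).
  apply: (@ccont_lip _ _ (2 * (18 * rho) * L)) => y y'.
  have := @cder_lip R _ _ (18 * rho * `|y - y'|) 0 L (fun x => cderB (dF y x) (dF y' x)).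
  rewrite !F0 subrr subr0 subr0 (ger0_norm (ltW L0)) => H.
  apply: le_trans (H _) _; last by rewrite le_eqVlt; apply/orP; left; apply/eqP; ring.
  move=> x.
  have -> : W x / B y x - W x / B y' x =
      2 * rho%:C * (t y' - t y)%:C * W x * W x * (B y x)^-1 * (B y' x)^-1.
    have sE : s y' - s y = rho%:C * (t y' - t y)%:C.
      rewrite /s -mulrBr; congr (_ * _).
      by apply: eq_reim; rewrite ?reCD ?imCD ?reCN ?imCN //= subrr.
    have BE : B y' x - B y x = 2 * (rho%:C * (t y' - t y)%:C) * W x.
      by rewrite -sE /B /laxB /z; ring.
    rewrite [RHS](_ : _ = W x * (B y' x - B y x) * (B y x)^-1 * (B y' x)^-1).
      by field; rewrite !B0.
    by rewrite BE; ring.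
  have n2 : absC (2 : R[i]) <= 2 by rewrite absC_nat.
  have hr : absC (rho%:C : R[i]) <= rho by rewrite absC_real (ger0_norm (ltW rho_gt0)).
  have ht : absC ((t y' - t y)%:C : R[i]) <= `|y - y'|.
    by rewrite absC_real distrC (le_trans (tlip _ _)) // mul1r.
  have hi v : absC (B v x)^-1 <= rho^-1 by apply: absC_leV => //; exact: (laxB_ge (t1 v)).
  have hW := W_le x.
  apply: le_trans (absC_leM (absC_leM (absC_leM (absC_leM
    (absC_leM (absC_leM n2 hr) ht) hW) hW) (hi y)) (hi y')) _.
  rewrite (_ : _ * rho^-1 = 18 * rho * `|y - y'|) //.
  by field; rewrite lt0r_neq0.
have cz : ccont z.
  apply: ccontD (ccont_cst _) (ccontM (ccont_cst _) _).
  split; first by move=> y; exact: continuous_sin.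
  by move=> y; exact: cvg_cst.
have cphi : ccont phi.
  apply: ccontM; last by apply: ccontM.
  rewrite /laxdet /laxA /laxB /laxC.
  apply: ccontD; first apply: ccontM.
  1,2: apply: ccontD (ccont_cst _); apply: ccontD (ccont_cst _);
    by apply: ccontM (ccont_cst _) _; exact: ccontM.
  apply: ccontM (ccont_cst _); apply: ccontM; apply: ccontD (ccont_cst _);
    apply: ccontM (ccont_cst _); by apply: ccontM (ccont_cst _) _.
have im_re y : exists (kap : R) (e : R[i]), [/\ 0 < kap, absC e <= 2^-1,
    imC (phi y) = kap * (- 4 * t y + imC e) &
    reC (phi y) = kap * (- (1 + 4 * t y ^+ 2) + reC e)].
  have [kap [e [kap0 he E]]] := lax_product_approx (t1 y) (dF y) (F0 y).
  have E' : - (1 + 4 * t y ^+ 2)%:C - 4 * iC * (t y)%:C + e =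
      (- (1 + 4 * t y ^+ 2) + reC e) +i* (- 4 * t y + imC e).
    have -> : (4 : R[i]) = 4%:C by rewrite rmorph_nat.
    by apply: eq_reim; rewrite ?reCD ?imCD ?reCN ?imCN ?reCM ?imCM /=; ring.
  exists kap, e; split => //; rewrite /phi /z /s E E' ?imCM ?reCM /=; ring.
have imL : imC (phi (pi / 2)) <= 0.
  have [kap [e [kap0 he -> _]]] := im_re (pi / 2).
  rewrite /t sin_pihalf; have := le_trans (ler_norm _) (le_trans (ler_imC e) he).
  by nra.
have imR : 0 <= imC (phi (- (pi / 2))).
  have [kap [e [kap0 he -> _]]] := im_re (- (pi / 2)).
  rewrite /t sinN sin_pihalf.
  have := le_trans (ler_norm _) (le_trans (ler_imC (- e)) (absC_leN he)).
  by rewrite imCN; nra.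
have [|||y _ hy] := @IVT R (@imC R \o phi) (- (pi / 2)) (pi / 2) 0.
- by rewrite ge0_cp // divr_ge0 ?pi_ge0.
- by apply: continuous_subspaceT; case: cphi.
- by rewrite /= ge_min imL orbT le_max imR.
have [kap [e [kap0 he _ hre]]] := im_re y.
apply: (@unstable_mode_of_lax _ W W1 (z y) c L (F y)) => //.
- exact: B0.
- exact: (mean_im_neq0 (t1 y) (dF y) (F0 y)).
- have -> : laxdet W W1 (z y) 0 * F y L ^+ 2 = phi y by [].
  rewrite hre; have := le_trans (ler_norm _) (le_trans (ler_reC e) he).
  by have := sqr_ge0 (t y); nra.
Qed.

End Estimates.

(** * Function spaces *)

Section Spaces.
Context {R : realType}.
Implicit Types (f g h : R -> R) (Y : funspace R).

Definition decaying f := continuous f /\ exists M, forall x, `|f x| <= M / oneDsqr x.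

(** What the argument needs from the space Y, common to square-integrable and
    to bounded continuous functions. *)
Record admissible Y : Prop := Admissible {
  adm_eq : forall f, feq Y f f;
  adm_deriv : forall f g, (forall x : R, is_derive x 1 f (g x)) ->
    continuous g -> fderiv Y f g;
  adm_mem : forall f, decaying f -> fmem Y f;
  adm_norm_le : forall (c : R) f g, 0 <= c -> continuous f -> continuous g ->
    (forall x, 0 <= f x <= c * g x) -> (fnorm Y f <= c%:E * fnorm Y g)%E;
  adm_norm_ge0 : forall f, (0 <= fnorm Y f)%E;
  adm_norm_gt0 : forall f, continuous f -> (forall x, 0 < f x) -> (0 < fnorm Y f)%E;
  adm_norm_fin : forall f, decaying f -> (fnorm Y f < +oo)%E
}.

Lemma Cb_admissible : admissible (Cb_space R).
Proof.
have dle f : decaying f -> exists M, forall x, `|f x| <= M.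
  move=> [_ [M hM]]; exists M => x; apply: le_trans (hM x) _.
  have M0 : 0 <= M.
    by have := le_trans (normr_ge0 _) (hM 0); rewrite pmulr_lge0 // invr_gt0 (lt_le_trans _ (oneDsqr_ge1 0)).
  by rewrite ler_piMr // invf_le1 ?oneDsqr_ge1 // (lt_le_trans _ (oneDsqr_ge1 x)).
have sup f x : (`|f x|%:E <= fnorm (Cb_space R) f)%E.
  by apply: ereal_sup_ubound; exists x.
split.
- by [].
- by [].
- by move=> f df; split; [case: df|exact: dle].
- move=> c f g c0 _ _ fg; apply: ge_ereal_sup => _ [x _ <-].
  have /andP[f0 h] := fg x.
  rewrite ger0_norm //; apply: (@le_trans _ _ (c%:E * `|g x|%:E)%E).
    by rewrite -EFinM lee_fin (le_trans h) // ler_wpM2l // ler_norm.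
  by apply: lee_wpmul2l; rewrite ?lee_fin.
- by move=> f; apply: le_trans (sup f 0); rewrite lee_fin.
- by move=> f _ f0; apply: lt_le_trans (sup f 0); rewrite lte_fin normr_gt0 gt_eqF.
- move=> f /dle[M hM]; apply: (@le_lt_trans _ _ M%:E); last exact: ltry.
  by apply: ge_ereal_sup => _ [x _ <-]; rewrite lee_fin.
Qed.

Local Notation mu := (@lebesgue_measure R).

Lemma integral_oneDsqrV : (\int[mu]_x ((oneDsqr x)^-1)%:E < +oo)%E.
Proof.
rewrite (ge0_symfun_integralT (f := fun x => (oneDsqr x)^-1)).
- by rewrite -set_itvcy integral0y_oneDsqr -EFinM ltry.
- by move=> x; rewrite invr_ge0 (le_trans _ (oneDsqr_ge1 x)).
- exact: continuous_oneDsqrV.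
- by move=> x; rewrite /oneDsqr /= sqrrN.
Qed.

Lemma Lnorm2E f : Lnorm mu 2%:E (EFin \o f) = ((\int[mu]_x (f x ^+ 2)%:E) `^ 2^-1)%E.
Proof.
rewrite unlock; congr (_ `^ _)%E; apply: eq_integral => x _ /=.
by rewrite powR_mulrn // real_normK ?num_real.
Qed.

Lemma integral_sqr_ge0 f : (0 <= \int[mu]_x (f x ^+ 2)%:E)%E.
Proof. by apply: integral_ge0 => x _; rewrite lee_fin sqr_ge0. Qed.

Lemma Lnorm2_fin f : decaying f -> (Lnorm mu 2%:E (EFin \o f) < +oo)%E.
Proof.
move=> [cf [M hM]]; rewrite Lnorm2E; apply: poweR_lty.
have mf : measurable_fun setT (EFin \o (fun x : R => f x ^+ 2)).
  apply/measurable_EFinP; apply: continuous_measurable_fun => x.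
  by apply: continuousM; exact: cf.
apply: (@le_lt_trans _ _ (\int[mu]_x ((M ^+ 2)%:E * ((oneDsqr x)^-1)%:E))%E).
  apply: ge0_le_integral => //.
  - by move=> x _; rewrite lee_fin sqr_ge0.
  - apply: measurable_funeM; apply/measurable_EFinP.
    by apply: continuous_measurable_fun; exact: continuous_oneDsqrV.
  - move=> x _; rewrite -EFinM lee_fin -real_normK ?num_real //.
    have o1 := oneDsqr_ge1 x; have o0 : 0 < oneDsqr x := lt_le_trans ltr01 o1.
    have i1 : (oneDsqr x)^-1 <= 1 by rewrite invf_le1.
    have i0 : 0 < (oneDsqr x)^-1 by rewrite invr_gt0.
    have h := hM x; have h0 := normr_ge0 (f x).
    apply: le_trans (_ : (M / oneDsqr x) ^+ 2 <= _).
      by rewrite lerXn2r ?nnegrE // (le_trans h0).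
    by rewrite exprMn ler_wpM2l ?sqr_ge0 // expr2 ler_piMl // ltW.
rewrite ge0_integralZl_EFin ?sqr_ge0 //.
- by apply: lte_mul_pinfty; rewrite ?lee_fin ?sqr_ge0 // integral_oneDsqrV.
- apply/measurable_EFinP; apply: continuous_measurable_fun.
  exact: continuous_oneDsqrV.
Qed.

(** Test functions vanish outside of a bounded interval, where the integration
    by parts takes place without boundary terms. *)
Lemma weak_deriv_C1 f g : (forall x : R, is_derive x 1 f (g x)) ->
  continuous g -> weak_deriv f g.
Proof.
move=> df cg phi [sphi [M phi0]].
have dphi (x : R) : is_derive x 1 phi (derive1 phi x).
  by rewrite derive1E; apply/derivableP; exact: (sphi 0%N).
have cphi : continuous phi by move=> x; exact: rder_continuous (dphi x).
have cphi1 : continuous (derive1 phi).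
  by move=> x; apply: differentiable_continuous; apply/derivable1_diffP; exact: (sphi 1%N).
have cf : continuous f by move=> x; exact: rder_continuous (df x).
pose N := `|M| + 1.
have N0 : 0 < N by rewrite ltr_wpDl.
have NN : - N < N by rewrite -subr_gt0 opprK addr_gt0.
have out x : N <= `|x| -> phi x = 0.
  move=> h; apply: phi0; apply: lt_le_trans h.
  by rewrite (le_lt_trans (ler_norm M)) // ltrDl.
have out1 x : N < `|x| -> derive1 phi x = 0.
  move=> h; have [d0] : is_derive x 1 phi 0.
    apply: (@near_eq_is_derive _ _ _ (cst 0)).
    near=> y; apply/esym/out.
    have hd : `|x - y| < `|x| - N.
      by near: y; apply: (@cvgr_dist_lt _ _ _ (nbhs x) _ id) => //; rewrite subr_gt0.
    by have := lerB_dist x y; lra.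
  by rewrite derive1E.
have cut (u : R -> R) : (forall x, N < `|x| -> u x = 0) ->
    Rintegral mu setT u = Rintegral mu `[- N, N]%classic u.
  move=> hu; rewrite /Rintegral; congr fine.
  rewrite [RHS]integral_mkcond; apply: eq_integral => x _; rewrite patchE.
  case: ifPn => //; rewrite notin_setE /= in_itv /= => /negP h.
  by rewrite hu // ltNge ler_norml.
rewrite (cut (fun x => f x * derive1 phi x)); last by move=> x h; rewrite out1 ?mulr0.
rewrite (cut (fun x => g x * phi x)); last by move=> x h; rewrite out ?mulr0 ?ltW.
have doo (F F' : R -> R) : (forall x : R, is_derive x 1 F (F' x)) -> continuous F ->
    derivable_oo_LRcontinuous F (- N) N.
  move=> dF cF; split.
  - by move=> x _; have := dF x.
  - exact: cvg_at_right_filter (cF _).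
  - exact: cvg_at_left_filter (cF _).
rewrite (@Rintegration_by_parts R f phi g (derive1 phi)) //.
- rewrite !out ?mulr0 ?subrr ?sub0r //.
  + by rewrite normrN ger0_norm // ltW.
  + by rewrite ger0_norm // ltW.
- exact: continuous_subspaceT.
- exact: doo df cf.
- by move=> x _; rewrite derive1E; exact: derive_val.
- exact: continuous_subspaceT.
- exact: doo dphi cphi.
Unshelve. all: by end_near. Qed.

Lemma L2_admissible : admissible (L2_space R).
Proof.
split.
- by move=> f; exact/nearW.
- exact: weak_deriv_C1.
- move=> f df; apply/andP; split; rewrite inE /=.
    by apply: continuous_measurable_fun; case: df.
  exact: Lnorm2_fin.
- move=> c f g c0 cf cg fg; rewrite /= !Lnorm2E.
  have -> : c%:E = (((c ^+ 2)%:E) `^ 2^-1)%E.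
    by rewrite poweR_EFin -powR_mulrn // -powRrM divff // powRr1.
  rewrite -poweRM ?lee_fin ?sqr_ge0 ?integral_sqr_ge0 //.
  have mg : measurable_fun setT (EFin \o (fun x : R => g x ^+ 2)).
    apply/measurable_EFinP; apply: continuous_measurable_fun => x.
    by apply: continuousM; exact: cg.
  have mf : measurable_fun setT (EFin \o (fun x : R => f x ^+ 2)).
    apply/measurable_EFinP; apply: continuous_measurable_fun => x.
    by apply: continuousM; exact: cf.
  rewrite -ge0_integralZl_EFin ?sqr_ge0 //; last by move=> x _; rewrite lee_fin sqr_ge0.
  apply: gt0_ler_poweR; rewrite ?invr_ge0 ?in_itv /= ?leey ?integral_sqr_ge0 //.
    by rewrite andbT; apply: integral_ge0 => x _; rewrite -EFinM lee_fin mulr_ge0 ?sqr_ge0.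
  apply: ge0_le_integral => //.
  + by move=> x _; rewrite lee_fin sqr_ge0.
  + exact: measurable_funeM.
  + move=> x _; rewrite -EFinM lee_fin -exprMn.
    have /andP[f0 h] := fg x.
    by rewrite lerXn2r ?nnegrE // (le_trans f0).
- by move=> f; exact: Lnorm_ge0.
- move=> f cf f0; rewrite lt_def Lnorm_ge0 andbT; apply/eqP.
  move=> /Lnorm_eq0_eq0 h.
  have mf : measurable_fun setT (EFin \o f).
    by apply/measurable_EFinP; exact: continuous_measurable_fun.
  have [A [mA A0 sA]] := h mf (ltr0n _ 2).
  have AT x : A x.
    apply: sA => /= /(_ I) /= e; have := f0 x.
    by move: e => [->]; rewrite ltxx.
  have : (mu `[0%R, 1%R]%classic <= mu A)%E by apply: le_measure; rewrite ?inE.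
  rewrite A0 lebesgue_measure_itv /= lte_fin ltr01 sube0 lee_fin.
  by rewrite leNgt ltr01.
- exact: Lnorm2_fin.
Qed.

End Spaces.

(** * From bounded modes to the spectrum *)

Section Cutoff.
Context {R : realType}.
Implicit Types e x : R.

(** A rational cutoff, whose derivatives are small relative to its own value at
    every point; a compactly supported cutoff does not have this property. *)
Definition cutoff e x := (oneDsqr (e * x))^-1.
Definition cutoff1 e x := - (2 * e * (e * x)) * cutoff e x ^+ 2.
Definition cutoff2 e x := - (2 * e ^+ 2) * cutoff e x ^+ 2
  + 8 * e ^+ 2 * (e * x) ^+ 2 * cutoff e x ^+ 3.

Lemma oneDsqr_pos x : 0 < oneDsqr x.
Proof. exact: lt_le_trans (oneDsqr_ge1 x). Qed.

Lemma cutoff_gt0 e x : 0 < cutoff e x.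
Proof. by rewrite invr_gt0 oneDsqr_pos. Qed.

Lemma is_derive_cutoff e x : is_derive x 1 (cutoff e) (cutoff1 e x).
Proof.
have h : is_derive x 1 (fun y => oneDsqr (e * y)) (2 * e * (e * x)).
  rewrite (_ : (fun y => _) = fun y => (e * y + 0) * (e * y + 0) + 1).
    apply: (rder_eq (rderD (rderM (rder_lin e 0 x) (rder_lin e 0 x)) (is_derive_cst (1 : R) x 1))).
    by ring.
  by apply/funext => y; rewrite /oneDsqr; ring.
rewrite (_ : cutoff e = fun y => (oneDsqr (e * y))^-1) //.
apply: (rder_eq (rderV (f := fun y => oneDsqr (e * y)) (lt0r_neq0 (oneDsqr_pos (e * x))) h)).
by rewrite /cutoff1 /cutoff; field; rewrite lt0r_neq0 ?oneDsqr_pos.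
Qed.

Lemma is_derive_cutoff1 e x : is_derive x 1 (cutoff1 e) (cutoff2 e x).
Proof.
have h := is_derive_cutoff e x.
rewrite (_ : cutoff1 e = fun y => ((- 2 * e ^+ 2) * y + 0) * (cutoff e y * cutoff e y)).
  apply: (rder_eq (rderM (rder_lin _ 0 x) (rderM h h))).
  by rewrite /cutoff2 /cutoff1; ring.
by apply/funext => y; rewrite /cutoff1; ring.
Qed.

Lemma cutoff1_le e x : 0 < e -> `|cutoff1 e x| <= e * cutoff e x.
Proof.
move=> e0; have c0 := cutoff_gt0 e x; rewrite /cutoff1.
rewrite normrM (ger0_norm (sqr_ge0 _)) expr2 [X in X <= _]mulrA ler_wpM2r ?(ltW c0) //.
rewrite /cutoff; move: (e * x) => y.
rewrite normrN !normrM (gtr0_norm e0) ger0_norm // ler_pdivrMr ?oneDsqr_pos // /oneDsqr.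
have : 0 <= e * (`|y| - 1) ^+ 2 by rewrite mulr_ge0 ?sqr_ge0 // ltW.
by rewrite -[y ^+ 2]real_normK ?num_real //; lra.
Qed.

Lemma cutoff2_le e x : 0 < e -> e <= 1 -> `|cutoff2 e x| <= 10 * e * cutoff e x.
Proof.
move=> e0 e1; rewrite /cutoff2; set y := e * x; have c0 := cutoff_gt0 e x.
have c1 : cutoff e x <= 1 by rewrite invf_le1 ?oneDsqr_pos ?oneDsqr_ge1.
have yc : y ^+ 2 * cutoff e x <= 1.
  rewrite /cutoff -/y ler_pdivrMr ?oneDsqr_pos // mul1r /oneDsqr.
  by rewrite lerDr.
have yc0 : 0 <= y ^+ 2 * cutoff e x by rewrite mulr_ge0 ?sqr_ge0 // ltW.
rewrite (_ : _ + _ = e ^+ 2 * cutoff e x * (cutoff e x * (8 * (y ^+ 2 * cutoff e x) - 2))); last by ring.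
rewrite !normrM (gtr0_norm c0) (gtr0_norm e0).
have h1 : `|8 * (y ^+ 2 * cutoff e x) - 2| <= 10.
  by rewrite ler_norml; apply/andP; split; lra.
have h2 : cutoff e x * `|8 * (y ^+ 2 * cutoff e x) - 2| <= 10.
  by apply: le_trans h1; apply: ler_piMl.
apply: (@le_trans _ _ (e ^+ 2 * cutoff e x * 10)).
  by apply: ler_wpM2l => //; rewrite mulr_ge0 ?sqr_ge0 // ltW.
rewrite mulrC mulrA ler_wpM2r ?(ltW c0) // ler_wpM2l //.
by rewrite expr2; apply: ler_piMl; first exact: ltW.
Qed.

Lemma cutoff_decay e x : 0 < e -> e <= 1 -> cutoff e x <= e ^- 2 / oneDsqr x.
Proof.
move=> e0 e1; rewrite /cutoff -invfM lef_pV2 ?posrE ?mulr_gt0 ?exprn_gt0 ?oneDsqr_pos //.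
rewrite /oneDsqr mulrDr mulr1 exprMn lerD2r.
by rewrite expr_le1 // ltW.
Qed.

End Cutoff.

Section Pairs.
Context {R : realType}.
Implicit Types (u v : R[i]).

(** The two components of the complexified space in terms of the function and of
    what replaces its complex conjugate. *)
Definition pair_of u v : R[i] * R[i] :=
  ((2^-1)%:C * (u + v), (2^-1)%:C * (- iC * (u - v))).
Definition re_of u v : R[i] := (2^-1)%:C * (u + cj v).
Definition im_of u v : R[i] := (2^-1)%:C * (- iC * (u - cj v)).

Lemma w_re_pair_of (u v : R -> R[i]) :
  w_re (fun x => pair_of (u x) (v x)) = fun x => re_of (u x) (v x).
Proof.
apply/funext => x; rewrite /w_re /pair_of /re_of /=.
case: (u x) => a b; case: (v x) => c d.
by apply: eq_reim; rewrite /= ?reCM ?imCM ?reCN ?imCN ?reCD ?imCD ?reCN ?imCN /=; ring.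
Qed.

Lemma w_im_pair_of (u v : R -> R[i]) :
  w_im (fun x => pair_of (u x) (v x)) = fun x => im_of (u x) (v x).
Proof.
apply/funext => x; rewrite /w_im /pair_of /im_of /=.
case: (u x) => a b; case: (v x) => c d.
by apply: eq_reim; rewrite /= ?reCM ?imCM ?reCN ?imCN ?reCD ?imCD ?reCN ?imCN /=; ring.
Qed.

Lemma pair_of_lin (l u v u' v' : R[i]) :
  (l * (pair_of u v).1 + (pair_of u' v').1, l * (pair_of u v).2 + (pair_of u' v').2)
  = pair_of (l * u + u') (l * v + v').
Proof. by rewrite /pair_of /=; congr pair; ring. Qed.

Lemma absC_pair_of u v : absC (pair_of u v).1 ^+ 2 + absC (pair_of u v).2 ^+ 2 =
  (absC u ^+ 2 + absC v ^+ 2) / 2.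
Proof.
rewrite !absC_sqr /pair_of; case: u => a b; case: v => c d.
rewrite /= ?reCM ?imCM ?reCD ?imCD ?reCM ?imCM ?reCN ?imCN ?reCD ?imCD ?reCN ?imCN /=.
by field.
Qed.

Lemma cder_re_of (u v : R -> R[i]) x a b : cder u x a -> cder v x b ->
  cder (fun y => re_of (u y) (v y)) x (re_of a b).
Proof. by move=> ha hb; exact: cderZ (cderD ha (cder_conj hb)). Qed.

Lemma cder_im_of (u v : R -> R[i]) x a b : cder u x a -> cder v x b ->
  cder (fun y => im_of (u y) (v y)) x (im_of a b).
Proof. by move=> ha hb; exact: cderZ (cderZ _ (cderB ha (cder_conj hb))). Qed.

End Pairs.

Section Linearization.
Context {R : realType}.
Variables (p k : R) (Q : R -> R[i]).

(** lin is the formula of the linearized operator.  In the complexification, the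
    function and its conjugate become independent functions u and v: linu is lin
    with v for the conjugate of u, and linv is its conjugate with the roles of u
    and v exchanged. *)
Definition lin (q q1 q2 : R -> R[i]) (z : R) : R[i] :=
    (4 * k ^+ 2)%:C * iC * q2 z - (4 * p * k)%:C * q1 z
  + (1 - p ^+ 2)%:C * iC * q z + (2 * absC (Q z) ^+ 2)%:C * iC * q z
  + iC * Q z ^+ 2 * cj (q z).

Definition linu (u u1 u2 v : R -> R[i]) (z : R) : R[i] :=
    (4 * k ^+ 2)%:C * iC * u2 z - (4 * p * k)%:C * u1 z
  + (1 - p ^+ 2)%:C * iC * u z + (2 * absC (Q z) ^+ 2)%:C * iC * u z
  + iC * Q z ^+ 2 * v z.

Definition linv (u v v1 v2 : R -> R[i]) (z : R) : R[i] :=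
  - ((4 * k ^+ 2)%:C * iC * v2 z) - (4 * p * k)%:C * v1 z
  - (1 - p ^+ 2)%:C * iC * v z - (2 * absC (Q z) ^+ 2)%:C * iC * v z
  - iC * cj (Q z) ^+ 2 * u z.

Let J2 : (iC : R[i]) ^+ 2 = -1 := iC2.

Lemma lin_re_of (u u1 u2 v v1 v2 : R -> R[i]) z :
  lin (fun x => re_of (u x) (v x)) (fun x => re_of (u1 x) (v1 x))
      (fun x => re_of (u2 x) (v2 x)) z =
  re_of (linu u u1 u2 v z) (linv u v v1 v2 z).
Proof.
rewrite /lin /re_of /linu /linv.
rewrite !(conjCX, conjCD, conjCN, conjCM) !conjc_real !conjcK conj_iC.
by ring.
Qed.

Lemma lin_im_of (u u1 u2 v v1 v2 : R -> R[i]) z :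
  lin (fun x => im_of (u x) (v x)) (fun x => im_of (u1 x) (v1 x))
      (fun x => im_of (u2 x) (v2 x)) z =
  im_of (linu u u1 u2 v z) (linv u v v1 v2 z).
Proof.
rewrite /lin /im_of /linu /linv.
rewrite !(conjCX, conjCD, conjCN, conjCM) !conjc_real !conjcK !conj_iC.
by ring: J2.
Qed.

End Linearization.

Section Spectrum.
Context {R : realType}.
Variables (Y : funspace R).
Hypothesis hY : admissible Y.

Definition cdecaying (f : R -> R[i]) :=
  ccont f /\ exists M, forall x, absC (f x) <= M / oneDsqr x.

Lemma memY_cdecaying f : cdecaying f -> memY Y f.
Proof.
move=> [[cr ci] [M hM]]; split; apply: (adm_mem hY); split => //; exists M => x.
- exact: le_trans (ler_reC _) (hM x).
- exact: le_trans (ler_imC _) (hM x).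
Qed.

Lemma derivY_C1 f g : (forall x, cder f x (g x)) -> ccont g -> derivY Y f g.
Proof.
move=> h [cr ci]; split; apply: (adm_deriv hY) => // x; by have [] := h x.
Qed.

Lemma cdecayingD f g : cdecaying f -> cdecaying g -> cdecaying (fun x => f x + g x).
Proof.
move=> [cf [M hM]] [cg [N hN]]; split; first exact: ccontD.
by exists (M + N) => x; rewrite mulrDl; exact: absC_leD.
Qed.

Lemma cdecayingM f g : cdecaying f -> ccont g -> cbounded g ->
  cdecaying (fun x => f x * g x).
Proof.
move=> [cf [M hM]] cg [N hN]; split; first exact: ccontM.
by exists (M * N) => x; rewrite mulrAC; exact: absC_leM.
Qed.

Lemma cdecayingZ a f : cdecaying f -> cdecaying (fun x => a * f x).
Proof.
move=> hf; rewrite (_ : (fun _ => _) = fun x => f x * a).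
  exact: cdecayingM hf (ccont_cst a) (cbounded_cst a).
by apply/funext => x; rewrite mulrC.
Qed.

Lemma cdecayingJ f : cdecaying f -> cdecaying (fun x => cj (f x)).
Proof.
move=> [cf [M hM]]; split; first exact: ccontJ.
by exists M => x; rewrite absCJ.
Qed.

Lemma cdecaying_re_of f g : cdecaying f -> cdecaying g ->
  cdecaying (fun x => re_of (f x) (g x)).
Proof. by move=> hf hg; exact: cdecayingZ (cdecayingD hf (cdecayingJ hg)). Qed.

Lemma cdecaying_im_of f g : cdecaying f -> cdecaying g ->
  cdecaying (fun x => im_of (f x) (g x)).
Proof.
move=> hf hg; apply: cdecayingZ; apply: cdecayingZ; apply: (cdecayingD hf).
rewrite (_ : (fun _ => _) = fun x => -1 * cj (g x)).
  exact/cdecayingZ/cdecayingJ.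
by apply/funext => x; rewrite mulN1r.
Qed.

Definition pair_norm (u v : R -> R[i]) (x : R) : R :=
  Num.sqrt ((absC (u x) ^+ 2 + absC (v x) ^+ 2) / 2).

Lemma norm_pair_of u v : norm_complexified Y (fun x => pair_of (u x) (v x)) =
  fnorm Y (pair_norm u v).
Proof.
by rewrite /norm_complexified /pair_norm; under eq_fun do rewrite absC_pair_of.
Qed.

Lemma pair_norm_continuous u v : ccont u -> ccont v -> continuous (pair_norm u v).
Proof.
move=> [ur ui] [vr vi] x.
pose h y := (((reC \o u) y * (reC \o u) y + (imC \o u) y * (imC \o u) y) +
    ((reC \o v) y * (reC \o v) y + (imC \o v) y * (imC \o v) y)) * 2^-1.
have -> : pair_norm u v = Num.sqrt \o h.
  by apply/funext => y; rewrite /pair_norm !absC_sqr !expr2.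
have sq (f : R -> R) : continuous f -> {for x, continuous (fun y => f y * f y)}.
  by move=> cf; exact: continuousM (cf x) (cf x).
have ch : {for x, continuous h}.
  apply: continuousM; last exact: cvg_cst.
  by apply: continuousD; apply: continuousD; exact: sq.
exact: continuous_comp ch (@sqrt_continuous R _).
Qed.

Lemma pair_norm_le u v x (M : R) : absC (u x) <= M -> absC (v x) <= M ->
  pair_norm u v x <= M.
Proof.
move=> hu hv; have M0 : 0 <= M := le_trans (absC_ge0 _) hu.
rewrite -[M]ger0_norm // -sqrtr_sqr ler_wsqrtr //.
have u2 : absC (u x) ^+ 2 <= M ^+ 2 by rewrite lerXn2r ?nnegrE ?absC_ge0.
have v2 : absC (v x) ^+ 2 <= M ^+ 2 by rewrite lerXn2r ?nnegrE ?absC_ge0.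
by lra.
Qed.

Lemma pair_norm_ge u v x : absC (u x) / 2 <= pair_norm u v x.
Proof.
have h : 0 <= absC (u x) / 2 by rewrite divr_ge0 ?absC_ge0.
rewrite -[absC (u x) / 2]ger0_norm // -sqrtr_sqr ler_wsqrtr //.
have := sqr_ge0 (absC (u x)); have := sqr_ge0 (absC (v x)).
by rewrite exprMn; lra.
Qed.

(** Multiplication by a slowly varying cutoff turns a bounded mode, which is
    bounded away from zero, into elements of Y on which A - lambda is
    pointwise small compared with the elements themselves. *)
Lemma spectrum_of_bounded_mode (p k : R) (Q : R -> R[i]) (lambda : R[i])
    (U U1 U2 V V1 V2 : R -> R[i]) :
  (forall x, cder U x (U1 x)) -> (forall x, cder U1 x (U2 x)) -> ccont U2 ->
  (forall x, cder V x (V1 x)) -> (forall x, cder V1 x (V2 x)) -> ccont V2 ->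
  [/\ cbounded U, cbounded U1 & cbounded U2] ->
  [/\ cbounded V, cbounded V1 & cbounded V2] ->
  (exists2 c : R, 0 < c & forall x, c <= absC (U x)) ->
  (forall x, linu p k Q U U1 U2 V x = lambda * U x) ->
  (forall x, linv p k Q U V V1 V2 x = lambda * V x) ->
  spectrum Y (linearized_op Y p k Q) lambda.
Proof.
move=> dU dU1 cU2 dV dV1 cV2 [bU bU1 bU2] [bV bV1 bV2] [c c0 hc] eU eV.
move=> [_ _ [C hC]].
have [cU cU1 cV cV1] := And4 (ccont_cder dU) (ccont_cder dU1) (ccont_cder dV) (ccont_cder dV1).
have [M [M0 mU mU1 mV mV1]] : exists M, [/\ 0 < M, forall x, absC (U x) <= M,
    forall x, absC (U1 x) <= M, forall x, absC (V x) <= M & forall x, absC (V1 x) <= M].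
  have [[a ha] [b hb] [d hd] [g hg]] := And4 bU bU1 bV bV1.
  exists (1 + `|a| + `|b| + `|d| + `|g|).
  have := ler_norm a; have := ler_norm b; have := ler_norm d; have := ler_norm g.
  have := normr_ge0 a; have := normr_ge0 b; have := normr_ge0 d; have := normr_ge0 g.
  move=> *; split; first lra.
  - by move=> x; apply: le_trans (ha x) _; lra.
  - by move=> x; apply: le_trans (hb x) _; lra.
  - by move=> x; apply: le_trans (hd x) _; lra.
  - by move=> x; apply: le_trans (hg x) _; lra.
pose K := 4 * k ^+ 2 * (12 * M) + 4 * `|p * k| * M.
have K0 : 0 <= K.
  have h1 := mulr_ge0 (sqr_ge0 k) (ltW M0).
  have h2 := mulr_ge0 (normr_ge0 (p * k)) (ltW M0).
  by rewrite /K; lra.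
pose D := (`|C| + 1) * (2 * K / c + 1).
have D1 : 1 <= D.
  have h1 : 1 <= `|C| + 1 by rewrite lerDr.
  have h2 : 1 <= 2 * K / c + 1 by rewrite lerDr divr_ge0 ?mulr_ge0 // ltW.
  by rewrite -[1]mulr1 ler_pM.
(* For this e the resolvent bound would give norm w <= norm w / 2. *)
pose e := (2 * D)^-1.
have D0 : 0 < 2 * D by lra.
have e0 : 0 < e by rewrite invr_gt0.
have e1 : e <= 1 by rewrite invf_le1 //; lra.
pose X0 x := (cutoff e x)%:C : R[i].
pose X1 x := (cutoff1 e x)%:C : R[i].
pose X2 x := (cutoff2 e x)%:C : R[i].
have dX0 x : cder X0 x (X1 x) by exact: cder_real (is_derive_cutoff e x).
have dX1 x : cder X1 x (X2 x) by exact: cder_real (is_derive_cutoff1 e x).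
have cX0 : ccont X0 := ccont_cder dX0.
have cX1 : ccont X1 := ccont_cder dX1.
have c_cut : continuous (cutoff e) by move=> x; exact: rder_continuous (is_derive_cutoff e x).
have cX2 : ccont X2.
  apply: ccont_real => x; have h := is_derive_cutoff e x; have hy := rder_lin 1 0 x.
  have := rderD (rderM (is_derive_cst (- (2 * e ^+ 2)) x 1) (rderM h h))
    (rderM (is_derive_cst (8 * e ^+ 4) x 1) (rderM (rderM hy hy) (rderM h (rderM h h)))).
  move=> /rder_continuous; congr (continuous_at _ _).
  by apply/funext => y; rewrite /cutoff2 /=; ring.
have aX0 x : absC (X0 x) = cutoff e x by rewrite absC_real gtr0_norm // cutoff_gt0.
have aX1 x : absC (X1 x) <= e * cutoff e x by rewrite absC_real; exact: cutoff1_le.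
have aX2 x : absC (X2 x) <= 10 * e * cutoff e x by rewrite absC_real; exact: cutoff2_le.
have decX0 : cdecaying X0.
  by split => //; exists (e ^- 2) => x; rewrite aX0; exact: cutoff_decay.
have decX (f : R -> R[i]) (r : R) : ccont f -> 0 <= r ->
    (forall x, absC (f x) <= r * cutoff e x) -> cdecaying f.
  move=> cf r0 hf; split => //; exists (r * e ^- 2) => x; apply: le_trans (hf x) _.
  by rewrite -mulrA ler_wpM2l // cutoff_decay.
have decX1 : cdecaying X1 by exact: decX cX1 (ltW e0) aX1.
have decX2 : cdecaying X2 by apply: decX cX2 _ aX2; rewrite mulr_ge0 // ltW.
pose u0 x := X0 x * U x; pose v0 x := X0 x * V x.
pose u1 x := X1 x * U x + X0 x * U1 x; pose v1 x := X1 x * V x + X0 x * V1 x.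
pose u2 x := (X2 x * U x + X1 x * U1 x) + (X1 x * U1 x + X0 x * U2 x).
pose v2 x := (X2 x * V x + X1 x * V1 x) + (X1 x * V1 x + X0 x * V2 x).
have du0 x : cder u0 x (u1 x) by exact: cderM.
have dv0 x : cder v0 x (v1 x) by exact: cderM.
have du1 x : cder u1 x (u2 x) by exact: cderD (cderM _ _) (cderM _ _).
have dv1 x : cder v1 x (v2 x) by exact: cderD (cderM _ _) (cderM _ _).
have decu0 : cdecaying u0 by exact: cdecayingM.
have decv0 : cdecaying v0 by exact: cdecayingM.
have decu1 : cdecaying u1 by apply: cdecayingD; exact: cdecayingM.
have decv1 : cdecaying v1 by apply: cdecayingD; exact: cdecayingM.
have decu2 : cdecaying u2 by apply: cdecayingD; apply: cdecayingD; exact: cdecayingM.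
have decv2 : cdecaying v2 by apply: cdecayingD; apply: cdecayingD; exact: cdecayingM.
(* The commutators of the operator with the cutoff, applied to the mode. *)
pose fu x := (4 * k ^+ 2)%:C * iC * (X2 x * U x + 2 * X1 x * U1 x) - (4 * p * k)%:C * (X1 x * U x).
pose fv x := - ((4 * k ^+ 2)%:C * iC * (X2 x * V x + 2 * X1 x * V1 x)) - (4 * p * k)%:C * (X1 x * V x).
have Eu x : linu p k Q u0 u1 u2 v0 x = lambda * u0 x + fu x.
  rewrite [lambda * u0 x](_ : _ = X0 x * (lambda * U x)); last by rewrite /u0; ring.
  by rewrite -eU /linu /u0 /v0 /u1 /u2 /fu; ring.
have Ev x : linv p k Q u0 v0 v1 v2 x = lambda * v0 x + fv x.
  rewrite [lambda * v0 x](_ : _ = X0 x * (lambda * V x)); last by rewrite /v0; ring.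
  by rewrite -eV /linv /u0 /v0 /v1 /v2 /fv; ring.
have fbound (S : R[i]) (A A1 : R -> R[i]) x : absC S <= 1 ->
    (forall x, absC (A x) <= M) -> (forall x, absC (A1 x) <= M) ->
    absC (S * ((4 * k ^+ 2)%:C * iC * (X2 x * A x + 2 * X1 x * A1 x))
      - (4 * p * k)%:C * (X1 x * A x)) <= K * e * cutoff e x.
  move=> hS hA hA1.
  have n2 : absC (2 : R[i]) <= 2 by rewrite absC_nat.
  have k4 : absC ((4 * k ^+ 2)%:C * iC : R[i]) <= 4 * k ^+ 2.
    by rewrite absCM absC_iC mulr1 absC_real ger0_norm // mulr_ge0 ?sqr_ge0.
  have p4 : absC ((4 * p * k)%:C : R[i]) <= 4 * `|p * k|.
    by rewrite absC_real -mulrA normrM ger0_norm.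
  apply: le_trans (absC_leB (absC_leM hS (absC_leM k4 (absC_leD (absC_leM (aX2 x) (hA x))
    (absC_leM (absC_leM n2 (aX1 x)) (hA1 x))))) (absC_leM p4 (absC_leM (aX1 x) (hA x)))) _.
  by rewrite /K le_eqVlt; apply/orP; left; apply/eqP; ring.
have fuB x : absC (fu x) <= K * e * cutoff e x.
  have := @fbound 1 U U1 x; rewrite mul1r; apply => //.
  by rewrite (absC_real 1) normr1.
have fvB x : absC (fv x) <= K * e * cutoff e x.
  have := @fbound (-1) V V1 x; rewrite mulN1r; apply => //.
  by rewrite absCN (absC_real 1) normr1.
have cfu : ccont fu.
  apply: ccontD; first apply: ccontM (ccont_cst _) _.
    by apply: ccontD; apply: ccontM => //; apply: ccontM => //; exact: ccont_cst.
  by apply: ccontN; apply: ccontM (ccont_cst _) _; exact: ccontM.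
have cfv : ccont fv.
  apply: ccontD; first apply: ccontN; first apply: ccontM (ccont_cst _) _.
    by apply: ccontD; apply: ccontM => //; apply: ccontM => //; exact: ccont_cst.
  by apply: ccontN; apply: ccontM (ccont_cst _) _; exact: ccontM.
have KE0 : 0 <= K * e by rewrite mulr_ge0 // ltW.
have decfu : cdecaying fu by exact: decX KE0 fuB.
have decfv : cdecaying fv by exact: decX KE0 fvB.
pose w x := pair_of (u0 x) (v0 x); pose f x := pair_of (fu x) (fv x).
have memf : mem_complexified Y f.
  rewrite /mem_complexified /f w_re_pair_of w_im_pair_of; split; apply: memY_cdecaying.
  - exact: cdecaying_re_of.
  - exact: cdecaying_im_of.
have res : resolvent_eq (linearized_op Y p k Q) lambda w f.
  rewrite /resolvent_eq /complexified.
  have -> : (fun x => (lambda * (w x).1 + (f x).1, lambda * (w x).2 + (f x).2)) =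
      fun x => pair_of (lambda * u0 x + fu x) (lambda * v0 x + fv x).
    by apply/funext => x; exact: pair_of_lin.
  rewrite /w !w_re_pair_of !w_im_pair_of; split.
  - exists (fun x => re_of (u1 x) (v1 x)), (fun x => re_of (u2 x) (v2 x)); split.
    + by split; apply: memY_cdecaying; exact: cdecaying_re_of.
    + apply: derivY_C1 => [x|]; first exact: cder_re_of.
      by case: (cdecaying_re_of decu1 decv1).
    + apply: derivY_C1 => [x|]; first exact: cder_re_of.
      by case: (cdecaying_re_of decu2 decv2).
    + rewrite -[X in eqY Y _ X]/(lin p k Q _ _ _).
      rewrite (_ : lin _ _ _ _ _ _ = fun x => re_of (lambda * u0 x + fu x) (lambda * v0 x + fv x)).
        by split; exact: (adm_eq hY).
      by apply/funext => x; rewrite lin_re_of Eu Ev.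
  - exists (fun x => im_of (u1 x) (v1 x)), (fun x => im_of (u2 x) (v2 x)); split.
    + by split; apply: memY_cdecaying; exact: cdecaying_im_of.
    + apply: derivY_C1 => [x|]; first exact: cder_im_of.
      by case: (cdecaying_im_of decu1 decv1).
    + apply: derivY_C1 => [x|]; first exact: cder_im_of.
      by case: (cdecaying_im_of decu2 decv2).
    + rewrite -[X in eqY Y _ X]/(lin p k Q _ _ _).
      rewrite (_ : lin _ _ _ _ _ _ = fun x => im_of (lambda * u0 x + fu x) (lambda * v0 x + fv x)).
        by split; exact: (adm_eq hY).
      by apply/funext => x; rewrite lin_im_of Eu Ev.
have := hC w f memf res; rewrite !norm_pair_of.
have cw : continuous (pair_norm u0 v0).
  by apply: pair_norm_continuous; [case: decu0|case: decv0].
have cf : continuous (pair_norm fu fv) by exact: pair_norm_continuous.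
have w_ge x : c / 2 * cutoff e x <= pair_norm u0 v0 x.
  apply: le_trans (pair_norm_ge _ _ _); rewrite absCM aX0.
  by have := hc x; have := cutoff_gt0 e x; nra.
have w_gt0 x : 0 < pair_norm u0 v0 x.
  by apply: lt_le_trans (w_ge x); rewrite !mulr_gt0 ?invr_gt0 ?cutoff_gt0.
have decw : decaying (pair_norm u0 v0).
  split => //; exists (M * e ^- 2) => x; rewrite ger0_norm ?(ltW (w_gt0 x)) //.
  apply: (@le_trans _ _ (M * cutoff e x)); last by rewrite -mulrA ler_wpM2l ?(ltW M0) // cutoff_decay.
  by apply: pair_norm_le; rewrite absCM aX0 mulrC ler_wpM2r ?(ltW (cutoff_gt0 e x)).
have nw0 := adm_norm_gt0 hY cw w_gt0.
have nwf := adm_norm_fin hY decw.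
have KC0 : 0 <= 2 * K / c * e by rewrite !mulr_ge0 ?invr_ge0 // ltW.
have fw : (fnorm Y (pair_norm fu fv) <= (2 * K / c * e)%:E * fnorm Y (pair_norm u0 v0))%E.
  apply: (adm_norm_le hY) => // x; apply/andP; split; first exact: sqrtr_ge0.
  apply: le_trans (pair_norm_le (fuB x) (fvB x)) _.
  apply: le_trans (ler_wpM2l KC0 (w_ge x)).
  rewrite le_eqVlt; apply/orP; left; apply/eqP; field; exact: lt0r_neq0.
have fin : fnorm Y (pair_norm u0 v0) = (fine (fnorm Y (pair_norm u0 v0)))%:E.
  by rewrite fineK // ge0_fin_numE // ltW.
move: fw nw0; rewrite fin; set n := fine _ => fw n0.
have f_fin : (fnorm Y (pair_norm fu fv) <= (2 * K / c * e * n)%:E)%E by rewrite EFinM.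
move=> h.
have : (n%:E <= (`|C| * (2 * K / c * e * n))%:E)%E.
  apply: le_trans h _; rewrite EFinM.
  apply: (@le_trans _ _ (`|C|%:E * fnorm Y (pair_norm fu fv))%E).
    by apply: lee_wpmul2r; rewrite ?lee_fin ?ler_norm //; exact: adm_norm_ge0.
  by apply: lee_wpmul2l; rewrite ?lee_fin.
move: n0; rewrite lee_fin lte_fin => n0.
have : `|C| * (2 * K / c * e * n) <= 2^-1 * n.
  rewrite (_ : _ * (_ * n) = (`|C| * (2 * K / c) * e) * n); last by ring.
  rewrite ler_wpM2r ?(ltW n0) // /e invfM mulrCA -[leRHS]mulr1 ler_wpM2l ?invr_ge0 //.
  rewrite ler_pdivrMr; last by lra.
  rewrite mul1r /D ler_pM ?divr_ge0 ?mulr_ge0 ?(ltW c0) //; by rewrite lerDl.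
by lra.
Qed.

End Spectrum.

(** * The moving frame of the wave *)

Section Frame.
Context {R : realType}.

Lemma cder_frame (al h : R) (f f1 : R -> R[i]) z : (forall x, cder f x (f1 x)) ->
  cder (fun y => expi (al * y) * f (h * y)) z
    (expi (al * z) * (al%:C * iC * f (h * z) + h%:C * f1 (h * z))).
Proof.
move=> df.
have := cderM (cder_expi al 0 z) (@cder_comp_lin R f h 0 z _ (df (h * z + 0))).
rewrite !addr0 => H; apply: (cder_ext (f := fun y => expi (al * y + 0) * f (h * y + 0))).
  by move=> y; rewrite !addr0.
by apply: (cder_eq H); ring.
Qed.

Lemma cbounded_frame (al h : R) (f : R -> R[i]) : cbounded f ->
  cbounded (fun y => expi (al * y) * f (h * y)).
Proof. by move=> [M hM]; exists M => x; rewrite absCM absC_expi mul1r. Qed.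

Lemma ccont_frame (al h : R) (f : R -> R[i]) : ccont f ->
  ccont (fun y => expi (al * y) * f (h * y)).
Proof.
move=> [fr fi]; apply: ccontM.
  apply: (@ccont_cder _ _ (fun x => al%:C * (iC * expi (al * x)))) => x.
  have := cder_expi al 0 x; rewrite addr0; apply: cder_ext => y.
  by rewrite addr0.
have ch : continuous (fun y : R => h * y).
  by move=> y; apply: continuousM; [exact: cvg_cst|exact: cvg_id].
split=> x.
- exact: (@continuous_comp _ _ _ (fun y => h * y) (reC \o f) x (ch x) (fr (h * x))).
- exact: (@continuous_comp _ _ _ (fun y => h * y) (imC \o f) x (ch x) (fi (h * x))).
Qed.

(** In the variable z = 2 k x and after division by exp(i p x) the wave becomes Q;
    the mode (v, w) is divided by exp(i p x) and exp(- i p x) respectively. *)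
Lemma spectrally_unstable_of_mode (Y : funspace R) (ell k : R) (P W1 : R -> R[i]) :
  admissible Y -> 0 < k -> profile (wave_W ell k P) W1 ->
  cbounded (wave_W ell k P) -> unstable_mode (wave_W ell k P) ->
  spectrally_unstable Y ell k P.
Proof.
move=> hY k0; set W := wave_W ell k P => ode bW.
move=> [la [v [v1 [w [w1 [la0 [dvw dv1 dw1 [bv bv1 bw bw1] [c c0 hc]]]]]]]].
exists la; split => //.
pose p := wave_p ell k; pose h := (2 * k)^-1.
have kC : k%:C != 0 :> R[i] by rewrite fmorph_eq0 lt0r_neq0.
have dv x : cder v x (v1 x) by have [] := dvw x.
have dw x : cder w x (w1 x) by have [] := dvw x.
pose E z : R[i] := expi (- (p * h) * z); pose E' z : R[i] := expi (p * h * z).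
have EE z : E z * E' z = 1 by rewrite /E mulNr expiNV.
have QE z : wave_Q P z = E z * W (h * z).
  rewrite /wave_Q /W /wave_W mulrA -expiD; congr (expi _ * P _).
    by rewrite /p /wave_p /h; field; rewrite lt0r_neq0.
  by rewrite /h; field; rewrite lt0r_neq0.
have QJ z : cj (wave_Q P z) = E' z * cj (W (h * z)).
  by rewrite QE conjCM expiJ mulNr opprK.
have Qabs z : (2 * absC (wave_Q P z) ^+ 2)%:C = 2 * (W (h * z) * cj (W (h * z))).
  by rewrite (rmorphM _ 2) rmorph_nat mulCJ QE absCM absC_expi mul1r.
pose v2 x := - (1 + iC * la + 2 * (W x * cj (W x))) * v x - W x ^+ 2 * w x.
pose w2 x := - (1 - iC * la + 2 * (W x * cj (W x))) * w x - cj (W x) ^+ 2 * v x.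
have cW : ccont W := ccont_cder (cder_W ode).
have [cv cv1 cw cw1] := And4 (ccont_cder dv) (ccont_cder dv1) (ccont_cder dw) (ccont_cder dw1).
have bWJ := cboundedJ bW; have cWJ := ccontJ cW.
have b2 (l : R[i]) : cbounded (fun x => - (l + 2 * (W x * cj (W x)))).
  by apply: cboundedN; apply: cboundedD; [exact: cbounded_cst
    |apply: cboundedM; [exact: cbounded_cst|exact: cboundedM]].
have c2 (l : R[i]) : ccont (fun x => - (l + 2 * (W x * cj (W x)))).
  by apply: ccontN; apply: ccontD; [exact: ccont_cst
    |apply: ccontM; [exact: ccont_cst|exact: ccontM]].
have bv2 : cbounded v2.
  apply: cboundedD; first exact: cboundedM (b2 _) bv.
  by apply: cboundedN; apply: cboundedM => //; exact: cboundedX.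
have bw2 : cbounded w2.
  apply: cboundedD; first exact: cboundedM (b2 _) bw.
  by apply: cboundedN; apply: cboundedM => //; exact: (cboundedX 2 bWJ).
have cv2 : ccont v2.
  apply: ccontD; first exact: ccontM (c2 _) cv.
  by apply: ccontN; apply: ccontM => //; exact: ccontM.
have cw2 : ccont w2.
  apply: ccontD; first exact: ccontM (c2 _) cw.
  by apply: ccontN; apply: ccontM => //; exact: ccontM.
(* z-derivatives of expi (al * z) * f (h * z), without the exponential factor *)
pose D (al : R) (f f1 : R -> R[i]) x := al%:C * iC * f x + h%:C * f1 x.
have dD al f f1 f2 : (forall x, cder f x (f1 x)) -> (forall x, cder f1 x (f2 x)) ->
    forall x, cder (D al f f1) x (D al f1 f2 x).
  by move=> df df1 x; exact: cderD (cderZ _ (df x)) (cderZ _ (df1 x)).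
have bD al f f1 : cbounded f -> cbounded f1 -> cbounded (D al f f1).
  by move=> ? ?; apply: cboundedD; apply: cboundedM => //; exact: cbounded_cst.
have cD al f f1 : ccont f -> ccont f1 -> ccont (D al f f1).
  by move=> ? ?; apply: ccontD; apply: ccontM => //; exact: ccont_cst.
pose F (al : R) (f : R -> R[i]) z := expi (al * z) * f (h * z).
apply: (@spectrum_of_bounded_mode R Y hY p k (wave_Q P) la
  (F (- (p * h)) v) (F (- (p * h)) (D (- (p * h)) v v1))
  (F (- (p * h)) (D (- (p * h)) (D (- (p * h)) v v1) (D (- (p * h)) v1 v2)))
  (F (p * h) w) (F (p * h) (D (p * h) w w1))
  (F (p * h) (D (p * h) (D (p * h) w w1) (D (p * h) w1 w2)))).
- by move=> z; exact: cder_frame.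
- by move=> z; apply: cder_frame; exact: dD.
- by apply: ccont_frame; apply/cD; exact: cD.
- by move=> z; exact: cder_frame.
- by move=> z; apply: cder_frame; exact: dD.
- by apply: ccont_frame; apply/cD; exact: cD.
- by split; apply: cbounded_frame => //; [exact: bD|apply/bD; exact: bD].
- by split; apply: cbounded_frame => //; [exact: bD|apply/bD; exact: bD].
- by exists c => // x; rewrite absCM absC_expi mul1r.
- move=> z; rewrite /linu Qabs QE /F -/(E z) -/(E' z) /D.
  set e := E z; set e' := E' z; have ee : e * e' = 1 := EE z.
  rewrite [iC * (e * _) ^+ 2 * (e' * _)](_ : _ = iC * e * W (h * z) ^+ 2 * w (h * z)); last first.
    rewrite [LHS](_ : _ = iC * e * (e * e') * W (h * z) ^+ 2 * w (h * z)); last by ring.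
    by rewrite ee mulr1.
  by rewrite /v2 /h; field: (@iC2 R).
- move=> z; rewrite /linv Qabs QJ /F -/(E z) -/(E' z) /D.
  set e := E z; set e' := E' z; have ee : e * e' = 1 := EE z.
  rewrite [iC * (e' * _) ^+ 2 * (e * _)](_ : _ = iC * e' * cj (W (h * z)) ^+ 2 * v (h * z)); last first.
    rewrite [LHS](_ : _ = iC * e' * (e * e') * cj (W (h * z)) ^+ 2 * v (h * z)); last by ring.
    by rewrite ee mulr1.
  by rewrite /w2 /h; field: (@iC2 R).
Qed.

End Frame.

(** * Instability of the small periodic waves *)

Lemma norm2_ge (R : realType) (a b : R) : `|a| <= norm2 a b /\ `|b| <= norm2 a b.
Proof.
by rewrite -!sqrtr_sqr; split; rewrite ler_wsqrtr // ?lerDl ?lerDr sqr_ge0.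
Qed.

Lemma parameter_bounds (R : realType) (C rho a b l m : R) :
  `|a| <= rho -> `|b| <= rho -> rho * (6000 * (2 * `|C| + 1)) <= 1 ->
  `|l - (a ^+ 2 - b ^+ 2) / 4| <= C * (a ^+ 4 + b ^+ 4) ->
  `|m - (1 + 3 / 4 * (a ^+ 2 + b ^+ 2))| <= C * (a ^+ 4 + b ^+ 4) ->
  `|l| <= rho ^+ 2 /\ `|m - 1| <= 2 * rho ^+ 2.
Proof.
move=> ar br rK hl hm.
have rho0 : 0 <= rho := le_trans (normr_ge0 _) ar.
have C0 := normr_ge0 C.
have sq (t : R) : `|t| <= rho -> t ^+ 2 <= rho ^+ 2.
  by move=> h; rewrite -[t ^+ 2]real_normK ?num_real // lerXn2r ?nnegrE.
have a2 := sq a ar; have b2 := sq b br; have s0 := sqr_ge0 rho.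
have a20 := sqr_ge0 a; have b20 := sqr_ge0 b.
have r4 : C * (a ^+ 4 + b ^+ 4) <= rho ^+ 2 / 4.
  have q4 (t : R) : t ^+ 2 <= rho ^+ 2 -> t ^+ 4 <= rho ^+ 2 * rho ^+ 2.
    by move=> h; rewrite (exprM t 2 2) expr2 ler_pM ?sqr_ge0.
  have Cr : `|C| * rho <= 1 / 12000 by clear -rK rho0 C0; nra.
  have r1 : rho <= 1 by clear -rK rho0 C0; nra.
  have Cs : `|C| * rho ^+ 2 <= 1 / 12000.
    apply: le_trans Cr; rewrite ler_wpM2l // expr2; exact: ler_piMl.
  have q0 : 0 <= a ^+ 4 + b ^+ 4 by rewrite addr_ge0 // exprn_even_ge0.
  apply: le_trans (ler_wpM2r q0 (ler_norm C)) _.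
  apply: le_trans (ler_wpM2l C0 (lerD (q4 a a2) (q4 b b2))) _.
  by have := ler_wpM2r s0 Cs; clear -s0; lra.
split.
- have e : `|(a ^+ 2 - b ^+ 2) / 4| <= rho ^+ 2 / 4.
    by rewrite ler_norml; apply/andP; split; clear -a2 b2 a20 b20; lra.
  have := le_trans (ler_normD _ _) (lerD (le_trans hl r4) e).
  by rewrite subrK; clear -s0; lra.
- have e : `|3 / 4 * (a ^+ 2 + b ^+ 2)| <= 3 / 2 * rho ^+ 2.
    by rewrite ler_norml; apply/andP; split; clear -a2 b2 a20 b20 s0; lra.
  have := le_trans (ler_normD _ _) (lerD (le_trans hm r4) e).
  rewrite [X in `|X| <= _](_ : _ = m - 1); last by ring.
  by clear -s0; lra.
Qed.

Lemma profile_error_bound (R : realType) (C rho a b : R) :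
  `|a| <= rho -> `|b| <= rho ->
  C * (`|a * b| * (`|a| + `|b|)) <= (2 * `|C| + 1) * rho ^+ 3.
Proof.
move=> ar br; have rho0 : 0 <= rho := le_trans (normr_ge0 _) ar.
have h3 : `|a * b| * (`|a| + `|b|) <= rho * rho * (rho + rho).
  by rewrite normrM !ler_pM ?mulr_ge0 ?addr_ge0 ?lerD.
have h0 : 0 <= `|a * b| * (`|a| + `|b|) by rewrite mulr_ge0 ?addr_ge0.
apply: le_trans (ler_wpM2r h0 (ler_norm C)) _.
apply: le_trans (ler_wpM2l (normr_ge0 C) h3) _.
by have := mulr_ge0 (mulr_ge0 rho0 rho0) rho0; clear; lra.
Qed.

Theorem mainTheorem4 (R : realType) (Y : funspace R)
  (hY : Y = L2_space R \/ Y = Cb_space R)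
  (ell k : R -> R -> R) (P : R -> R -> R -> R[i])
  (hfam : small_wave_family ell k P) :
  exists delta : R, 0 < delta /\
    forall a b : R, a * b != 0 -> norm2 a b <= delta ->
      spectrally_unstable Y (ell a b) (k a b) (P a b).
Proof.
have aY : admissible Y.
  by case: hY => ->; [exact: L2_admissible|exact: Cb_admissible].
have [r [r0 _ hper _ [C hC]]] := hfam.
pose K := 2 * `|C| + 1.
have K1 : 1 <= K by rewrite lerDr mulr_ge0.
have K0 : 0 < 6000 * K by lra.
exists (Num.min (r / 2) (6000 * K)^-1); split.
  by rewrite lt_min divr_gt0 // invr_gt0.
move=> a b ab0; rewrite le_min => /andP[nr nK].
have nr' : norm2 a b < r by apply: le_lt_trans nr _; lra.
have [[k0 _ Ppi] [[W1 [W2 [dW dW1 eqW]]] _ _]] := hper a b nr'.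
have [hl hk hP] := hC a b nr'.
move: ab0; rewrite mulf_eq0 negb_or => /andP[a0 b0].
have [na nb] := norm2_ge a b.
set W := wave_W _ _ _ in dW eqW.
have ode : profile W W1.
  move=> x; split; first exact: dW.
  apply: (cder_eq (dW1 x)); rewrite mulCJ; have := eqW x; set n := _%:C => e.
  by rewrite -[RHS]add0r -e; ring.
pose L := pi / k a b.
have L0 : 0 < L by rewrite divr_gt0 ?pi_gt0.
pose c : R[i] := - expi (ell a b * L).
have c1 : absC c = 1 by rewrite absCN absC_expi.
have Wper x : W (x + L) = c * W x.
  rewrite /W /wave_W mulrDr expiD (_ : k a b * (x + L) = k a b * x + pi).
    by rewrite Ppi /c; ring.
  by rewrite mulrDr; congr (_ + _); rewrite /L mulrC divfK // lt0r_neq0.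
have bW : cbounded W.
  apply: (absC_periodic_bounded L0 (cder_W ode)) => x.
  by rewrite Wper absCM c1 mul1r.
apply: (spectrally_unstable_of_mode aY k0 ode bW).
have est (rho : R) : rho = Num.max `|a| `|b| ->
   [/\ rho * (6000 * K) <= 1, `|ell a b| <= rho ^+ 2, `|k a b - 1| <= 2 * rho ^+ 2 &
     forall y, absC (P a b y - (a%:C * expi (- y) + b%:C * expi y)) <= K * rho ^+ 3].
  move=> rE.
  have ar : `|a| <= rho by rewrite rE le_max lexx.
  have br : `|b| <= rho by rewrite rE le_max lexx orbT.
  have rn : rho <= (6000 * K)^-1 by rewrite rE ge_max !(le_trans _ nK).
  have rK : rho * (6000 * K) <= 1 by rewrite -ler_pdivlMr // div1r.
  have [hl' hk'] := parameter_bounds ar br rK hl hk.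
  by split => // y; apply: le_trans (hP y) _; exact: profile_error_bound.
(* The two cases are exchanged by the reflection x -> - x, which exchanges
   a and b and changes the sign of ell. *)
have [ba|/ltW ab] := leP `|b| `|a|.
- have [rK hl' hk' hP'] := est `|a| (esym (max_idPl ba)).
  apply: (@unstable_mode_of_estimates R W W1 (ell a b) (k a b) a b K c) => //.
  move=> x; apply: le_trans (hP' (k a b * x)).
  rewrite /W /wave_W [X in absC X](_ : _ = expi (ell a b * x) *
    (P a b (k a b * x) - (a%:C * expi (- (k a b * x)) + b%:C * expi (k a b * x)))).
    by rewrite absCM absC_expi mul1r.
  by rewrite mulrBl mulrDl !expiD; ring.
- have [rK hl' hk' hP'] := est `|b| (esym (max_idPr ab)).
  apply: unstable_mode_reflect.
  apply: (@unstable_mode_of_estimates R _ _ (- ell a b) (k a b) b a K c^-1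
    (profile_reflect ode)) => //.
  + by rewrite normrN.
  + by rewrite absCV c1 invr1.
  + move=> x; rewrite -[in RHS](subrK L (- x)) Wper mulKf; last by apply: absC_neq0; rewrite c1.
    by rewrite opprD.
  + move=> x; apply: le_trans (hP' (k a b * - x)).
    rewrite /W /wave_W [X in absC X](_ : _ = expi (ell a b * - x) *
     (P a b (k a b * - x) - (a%:C * expi (- (k a b * - x)) + b%:C * expi (k a b * - x)))).
      by rewrite absCM absC_expi mul1r.
    rewrite mulrBl mulrDl !expiD !mulrN !mulNr opprK; ring.
Qed.
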